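(* Assuming the Exponential Time Hypothesis, there is no $2^{o(k\log k)}m^{O(1)}$ time algorithm for Constrained Permutation.
   Context: Constrained Permutation: given subsets $S_1,\dots,S_m$ of $[k]$ (parameter $k$), find a permutation $\rho$ of $[k]$ such that for every $1\le i\le m$ there is $1\le j<k$ with $\rho(j),\rho(j+1)\in S_i$. The Exponential Time Hypothesis (ETH) states that there is no $2^{o(n)}$ time algorithm for 3SAT on $n$ variables. *)

(* Defs.v *)
From mathcomp Require Import all_boot all_order all_algebra all_fingroup.
From mathcomp Require Import all_classical all_reals all_analysis.
Import Order.TTheory GRing.Theory Num.Theory numFieldNormedType.Exports.

Set Implicit Arguments.
Unset Strict Implicit.
Unset Printing Implicit Defensive.

Local Open Scope classical_set_scope.
Local Open Scope ring_scope.

(** * Model of computation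

    The WHILE language of N. D. Jones, "Computability and Complexity from a
    Programming Perspective" (MIT Press, 1997), without its equality test.
    The data are binary trees; the basic operations are building a cell, taking
    either component of a cell, and testing whether a tree is the leaf, all at
    unit cost.  Trees can be shared in memory, so that up to polynomial factors
    the running time agrees with multitape Turing machine time. *)

Inductive tree : Type := Leaf | Node of tree & tree.

Definition hd (x : tree) : tree := if x is Node l _ then l else Leaf.
Definition tl (x : tree) : tree := if x is Node _ r then r else Leaf.

Inductive expr : Type :=
| Var of nat
| Nil
| Cons of expr & expr
| Hd of expr
| Tl of expr.

Inductive program : Type :=
| Assign of nat & expr
| Seq of program & program
| If of expr & program & program
| While of expr & program.

Definition store : Type := nat -> tree.

Definition update (s : store) (v : nat) (x : tree) : store :=
  fun w => if w == v then x else s w.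

Fixpoint eval (s : store) (e : expr) : tree :=
  match e with
  | Var v => s v
  | Nil => Leaf
  | Cons e1 e2 => Node (eval s e1) (eval s e2)
  | Hd e1 => hd (eval s e1)
  | Tl e1 => tl (eval s e1)
  end.

Fixpoint cost (e : expr) : nat :=
  match e with
  | Var _ | Nil => 1
  | Cons e1 e2 => (cost e1 + cost e2).+1
  | Hd e1 | Tl e1 => (cost e1).+1
  end.

(* [exec p s s' t]: started in store [s], [p] halts in store [s'] after time
   [t].  A test succeeds when its value is not [Leaf]. *)
Inductive exec : program -> store -> store -> nat -> Prop :=
| exec_Assign v e s :
    exec (Assign v e) s (update s v (eval s e)) (cost e).+1
| exec_Seq p q s1 s2 s3 t u :
    exec p s1 s2 t -> exec q s2 s3 u -> exec (Seq p q) s1 s3 (t + u)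
| exec_If_true e p q s1 s2 t :
    eval s1 e <> Leaf -> exec p s1 s2 t ->
    exec (If e p q) s1 s2 ((cost e).+1 + t)
| exec_If_false e p q s1 s2 t :
    eval s1 e = Leaf -> exec q s1 s2 t ->
    exec (If e p q) s1 s2 ((cost e).+1 + t)
| exec_While_true e p s1 s2 s3 t u :
    eval s1 e <> Leaf -> exec p s1 s2 t -> exec (While e p) s2 s3 u ->
    exec (While e p) s1 s3 ((cost e).+1 + t + u)
| exec_While_false e p s :
    eval s e = Leaf -> exec (While e p) s s (cost e).+1.

(* Variable 0 holds the input initially and the output at the end. *)
Definition runs (p : program) (x y : tree) (t : nat) : Prop :=
  exists s, exec p (update (fun=> Leaf) 0%N x) s t /\ s 0%N = y.

(** * Encoding of inputs and outputs *)

Fixpoint enc_nat (n : nat) : tree :=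
  if n is n'.+1 then Node Leaf (enc_nat n') else Leaf.

Definition enc_bool (b : bool) : tree := if b then Node Leaf Leaf else Leaf.

Definition enc_seq (T : Type) (enc : T -> tree) (s : seq T) : tree :=
  foldr (fun x => Node (enc x)) Leaf s.

Definition enc_set (k : nat) (A : {set 'I_k}) : tree :=
  enc_seq enc_bool [seq i \in A | i <- enum 'I_k].

Definition enc_perm (k : nat) (rho : 'S_k) : tree :=
  enc_seq (fun i => enc_nat (rho i)) (enum 'I_k).

(** * 3SAT and the Exponential Time Hypothesis *)

(* [(i, b)] is the literal that holds when variable [i] has value [b]. *)
Definition literal (n : nat) : Type := ('I_n * bool)%type.
Definition cnf (n : nat) : Type := seq (seq ('I_n * bool)).

(* A formula is a set of clauses: without [uniq] its length would not be
   bounded by any function of the number of variables, and no algorithm could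
   read it within a time bound depending on that number only. *)
Definition is_3cnf (n : nat) (phi : cnf n) : bool :=
  uniq phi && all (fun C => size C <= 3)%N phi.

Definition satisfiable (n : nat) (phi : cnf n) : Prop :=
  exists a : 'I_n -> bool, all (has (fun l : literal n => a l.1 == l.2)) phi.

Definition enc_literal (n : nat) (l : literal n) : tree :=
  Node (enc_nat l.1) (enc_bool l.2).

Definition enc_cnf (n : nat) (phi : cnf n) : tree :=
  Node (enc_nat n) (enc_seq (enc_seq (@enc_literal n)) phi).

(* A decision algorithm accepts by returning any tree other than [Leaf]. *)
Definition ETH (R : realType) : Prop :=
  ~ exists (p : program) (f : nat -> R),
      f =o_\oo (fun n : nat => n%:R : R) /\
      forall (n : nat) (phi : cnf n), is_3cnf phi ->
        exists (y : tree) (t : nat),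
          [/\ runs p (enc_cnf phi) y t,
              y <> Leaf <-> satisfiable phi
            & t%:R <= 2 `^ f n].

(** * Constrained Permutation *)

Definition CP_solution (k m : nat) (S : m.-tuple {set 'I_k}) (rho : 'S_k) :
    Prop :=
  forall i : 'I_m, exists j j' : 'I_k,
    [/\ (j' : nat) = j.+1, rho j \in tnth S i & rho j' \in tnth S i].

Definition enc_CP (k m : nat) (S : m.-tuple {set 'I_k}) : tree :=
  Node (enc_nat k) (enc_seq (@enc_set k) S).

(* The output returned for an instance without solution is [Leaf]. *)
Definition CP_finds (k m : nat) (S : m.-tuple {set 'I_k}) (y : tree) : Prop :=
  (exists2 rho : 'S_k, CP_solution S rho & y = Node (enc_perm rho) Leaf) \/
  (~ (exists rho : 'S_k, CP_solution S rho) /\ y = Leaf).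

Definition CP_decides (k m : nat) (S : m.-tuple {set 'I_k}) (y : tree) : Prop :=
  y <> Leaf <-> exists rho : 'S_k, CP_solution S rho.

(* Instances have at least one constraint: for [m = 0] a bound with the factor
   [m ^ c], [0 < c], would be zero. *)
Definition CP_algorithm (R : realType)
    (correct : forall k m : nat, m.-tuple {set 'I_k} -> tree -> Prop) : Prop :=
  exists (p : program) (f : nat -> R) (c : nat),
    f =o_\oo (fun k : nat => k%:R * ln (k%:R : R)) /\
    forall (k m : nat) (S : m.-tuple {set 'I_k}), (0 < m)%N ->
      exists (y : tree) (t : nat),
        [/\ runs p (enc_CP S) y t,
            correct k m S y
          & t%:R <= 2 `^ f k * m%:R ^+ c].

(* Main.v *)
Require Import Defs.
From mathcomp Require Import all_boot all_order all_algebra all_fingroup.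
From mathcomp Require Import all_classical all_reals all_analysis.
From mathcomp Require Import zify ring lra.
Import Defs.
Import Order.TTheory GRing.Theory Num.Theory numFieldNormedType.Exports.

(* Group the n variables of a formula into g = O(n / log n) groups of
   b = (log n) / 2 variables.  A path alternates between rows and columns; the
   row of a group is next to a column that carries an assignment of the group,
   one of B = 2^b = O(sqrt n).  Distinct rows use distinct columns, so the
   multiset of the assignments in use is guessed: there are at most 2^(g + B)
   guesses, and each gives an instance with k = O(g + B) elements, for which
   k log k = O(n).  As the number of constraints only has to be 2^o(n), 2^O(k)
   of them are affordable.  This makes two things easy.
   - Every set with more than half of the elements, except the set of all rows,
     is a constraint.  The even positions of the path are independent, so they
     must be the rows: rows are adjacent to columns only.
   - The formula need not be sparse.  Three copies of the table are kept equal
     by constraints, the i-th literal of a clause being read in the i-th copy.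
     The constraint for a clause consists of the rows of its variables and of
     the columns that make its literals true. *)

Set Implicit Arguments.
Unset Strict Implicit.
Unset Printing Implicit Defensive.

Local Open Scope nat_scope.

(** * A functional language compiled to WHILE *)

(** Several features answer concrete dangers. On a path a row has two neighbours and could read two
    values; hence the constraints that put a filler column on one side of it. With a single copy of
    the table, a clause on x and y could be met by the row of y next to a column that is good for x
    only. Once each literal position has its own copy, and each row must take its column from its
    own copy, a row and a column that meet a clause together speak of the same literal. Columns must
    be shared by all groups, or there would be g * B kinds of them; so the b bits of a column are
    repeated periodically and can be read at any variable. ETH is about programs of a fixed model,
    so the whole reduction has to be such a program. Bounded folds keep this manageable: the time is
    polynomial in the length of the longest list folded over, with a bound read off the syntax. That
    length is 2^O(g + B), hence 2^o(n), and crude estimates suffice. *)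

Inductive tm : Type :=
| tV of nat
| tN
| tC of tm & tm
| tH of tm
| tT of tm
| tI of tm & tm & tm
| tL of nat & tm & tm
| tF of nat & nat & tm & tm & tm.

(* WHILE variable 0 holds a stack of intermediate values, and the variable [x]
   of a term lives in WHILE variable [x.+1]. *)
Local Notation stk := (Var 0).
Local Notation "p ;; q" := (Seq p q) (at level 60, right associativity).

Fixpoint tls (n : nat) : expr := if n is n'.+1 then Tl (tls n') else stk.
Definition nth_stk (n : nat) : expr := Hd (tls n).

(** A binder saves the old value of its variable on the stack and restores it, so the net effect of
    a term is to push its value. During a loop the top of the stack consists of the accumulator, the
    remaining list and the saved values of [x] and [y]. *)
Fixpoint compile (e : tm) : program :=
  match e with
  | tV x => Assign 0 (Cons (Var x.+1) stk)
  | tN => Assign 0 (Cons Nil stk)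
  | tC a b =>
      compile a ;; compile b ;;
      Assign 0 (Cons (Cons (nth_stk 1) (nth_stk 0)) (tls 2))
  | tH a => compile a ;; Assign 0 (Cons (Hd (nth_stk 0)) (tls 1))
  | tT a => compile a ;; Assign 0 (Cons (Tl (nth_stk 0)) (tls 1))
  | tI c a b =>
      compile c ;;
      If (nth_stk 0) (Assign 0 (tls 1) ;; compile a)
                     (Assign 0 (tls 1) ;; compile b)
  | tL x a b =>
      compile a ;;
      Assign 0 (Cons (Var x.+1) stk) ;;
      Assign x.+1 (nth_stk 1) ;;
      Assign 0 (Cons (nth_stk 0) (tls 2)) ;;
      compile b ;;
      Assign x.+1 (nth_stk 1) ;;
      Assign 0 (Cons (nth_stk 0) (tls 2))
  | tF x y l i b =>
      compile l ;;
      compile i ;;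
      Assign 0 (Cons (nth_stk 0) (Cons (nth_stk 1)
                 (Cons (Var x.+1) (Cons (Var y.+1) (tls 2))))) ;;
      While (nth_stk 1)
        (Assign x.+1 (Hd (nth_stk 1)) ;;
         Assign y.+1 (nth_stk 0) ;;
         Assign 0 (Cons (Tl (nth_stk 1)) (tls 2)) ;;
         compile b) ;;
      Assign x.+1 (nth_stk 2) ;;
      Assign y.+1 (nth_stk 3) ;;
      Assign 0 (Cons (nth_stk 0) (tls 4))
  end.

(* Running time when every list folded over has length at most [L]. *)
Fixpoint tbound (L : nat) (e : tm) : nat :=
  match e with
  | tV _ | tN => 4
  | tC a b => tbound L a + tbound L b + 12
  | tH a | tT a => tbound L a + 8
  | tI c a b => tbound L c + tbound L a + tbound L b + 8
  | tL _ a b => tbound L a + tbound L b + 30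
  | tF _ _ l i b => tbound L l + tbound L i + 60 + L * (tbound L b + 30)
  end.

Definition env : Type := nat -> tree.

(** The final store is prescribed completely, so that value, absence of side effects and time are
    all handled by one rule per constructor. The time bound ignores the size of the data, since
    cells are shared. *)
Definition evals (L : nat) (e : tm) (r : env) (v : tree) : Prop :=
  forall s : store, (forall x, s x.+1 = r x) ->
  exists2 t, exec (compile e) s (update s 0 (Node v (s 0))) t & t <= tbound L e.

Lemma exec_eq p s s' s'' t t' :
  exec p s s' t -> s' =1 s'' -> t = t' -> exec p s s'' t'.
Proof. by move=> h /funext <- <-. Qed.

Lemma exec_assign v e s s' t :
  update s v (eval s e) =1 s' -> t = (cost e).+1 -> exec (Assign v e) s s' t.
Proof. by move=> h ->; apply: exec_eq (exec_Assign v e s) h _. Qed.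

Lemma updateE s v x w : update s v x w = if w == v then x else s w.
Proof. by []. Qed.

Section Rules.
Variable L : nat.

Lemma evals_V x r : evals L (tV x) r (r x).
Proof.
move=> s hs; eexists; first by apply: exec_assign erefl => w; rewrite /= hs.
by [].
Qed.

Lemma evals_N r : evals L tN r Leaf.
Proof. by move=> s hs; eexists; first exact: exec_assign (frefl _) erefl. Qed.

Lemma evals_C a b r x y :
  evals L a r x -> evals L b r y -> evals L (tC a b) r (Node x y).
Proof.
move=> ha hb s hs; have [t1 e1 l1] := ha s hs.
have [|t2 e2 l2] := hb (update s 0 (Node x (s 0))); first by move=> w;
  apply: hs.
eexists.
  apply: exec_Seq e1 _; apply: exec_Seq e2 _; apply: exec_assign erefl => w.
  by rewrite /= !updateE; case: eqP.
by rewrite /=; lia.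
Qed.

Lemma evals_H a r x : evals L a r x -> evals L (tH a) r (hd x).
Proof.
move=> ha s hs; have [t1 e1 l1] := ha s hs; eexists.
  apply: exec_Seq e1 _; apply: exec_assign erefl => w.
  by rewrite /= !updateE; case: eqP.
by rewrite /=; lia.
Qed.

Lemma evals_T a r x : evals L a r x -> evals L (tT a) r (tl x).
Proof.
move=> ha s hs; have [t1 e1 l1] := ha s hs; eexists.
  apply: exec_Seq e1 _; apply: exec_assign erefl => w.
  by rewrite /= !updateE; case: eqP.
by rewrite /=; lia.
Qed.

Lemma evals_I c a b r x y :
  evals L c r x ->
  (x <> Leaf -> evals L a r y) -> (x = Leaf -> evals L b r y) ->
  evals L (tI c a b) r y.
Proof.
move=> hc ha hb s hs; have [t1 e1 l1] := hc s hs.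
have pop : exec (Assign 0 (tls 1)) (update s 0 (Node x (s 0))) s 3.
  by apply: exec_assign => // w; rewrite /= !updateE; case: eqP => // ->.
case: x hc ha hb e1 pop => [|x1 x2] hc ha hb e1 pop.
  have [t2 e2 l2] := hb erefl s hs; eexists.
    by apply: exec_Seq e1 _; apply: exec_If_false => //; apply: exec_Seq pop e2.
  by rewrite /=; lia.
have [//|t2 e2 l2] := ha _ s hs; eexists.
  by apply: exec_Seq e1 _; apply: exec_If_true => //; apply: exec_Seq pop e2.
by rewrite /=; lia.
Qed.

Lemma evals_L x a b r u v :
  evals L a r u -> evals L b (update r x u) v -> evals L (tL x a b) r v.
Proof.
move=> ha hb s hs; have [t1 e1 l1] := ha s hs.
pose s1 := update (update s x.+1 u) 0 (Node (s x.+1) (s 0)).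
have [|t2 e2 l2] := hb s1.
  by move=> w; rewrite /s1 /= !updateE /= eqSS; case: eqP => // _; rewrite hs.
eexists.
  apply: exec_Seq e1 _; apply: exec_Seq (exec_assign (frefl _) erefl) _.
  apply: exec_Seq (exec_assign (frefl _) erefl) _.
  apply: (@exec_Seq _ _ _ s1).
    by apply: exec_assign erefl => w; rewrite /s1 /= !updateE; case: w.
  apply: exec_Seq e2 _; apply: exec_Seq (exec_assign (frefl _) erefl) _.
  apply: exec_assign erefl => w.
  rewrite /s1 /= !updateE /=; case: w => //= w; rewrite eqSS.
  by case: eqP => // ->.
by rewrite /=; lia.
Qed.

(* [g s1] is the accumulator once the elements of [s1] have been processed,
   the last one being the head of [s1]. *)
Lemma evals_F (T : Type) (enc : T -> tree) (g : seq T -> tree) x y l i b r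
    (s : seq T) :
  evals L l r (enc_seq enc s) -> size s <= L -> evals L i r (g [::]) ->
  (forall s1 z s2, s = catrev s1 (z :: s2) ->
     evals L b (update (update r x (enc z)) y (g s1)) (g (z :: s1))) ->
  evals L (tF x y l i b) r (g (rev s)).
Proof.
move=> hl hL hi hb st hst; have [t1 e1 l1] := hl st hst.
have [|t2 e2 l2] := hi (update st 0 (Node (enc_seq enc s) (st 0))).
  by move=> w; apply: hst.
pose S v rest := Node v (Node (enc_seq enc rest)
                  (Node (st x.+1) (Node (st y.+1) (st 0)))).
pose mid (st' : store) v rest := [/\ st' 0 = S v rest &
  forall w, w <> x -> w <> y -> st' w.+1 = st w.+1].
have loop rest done st1 : s = catrev done rest -> mid st1 (g done) rest ->
  exists2 st2, mid st2 (g (rev s)) [::] &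
  exists2 t, exec (While (nth_stk 1)
        (Assign x.+1 (Hd (nth_stk 1)) ;;
         Assign y.+1 (nth_stk 0) ;;
         Assign 0 (Cons (Tl (nth_stk 1)) (tls 2)) ;;
         compile b)) st1 st2 t & t <= size rest * (tbound L b + 30) + 4.
  elim: rest done st1 => [|z rest IH] done st1 sE [st0 stw].
    exists st1; first by split; rewrite // sE -/(rev done) revK.
    exists 4; last by [].
    by apply: exec_While_false; rewrite /= st0.
  pose st2 : store := fun w => if w is w'.+1 then
      update (update (fun v => st v.+1) x (enc z)) y (g done) w'
    else Node (enc_seq enc rest) (tl (tl (st1 0))).
  have [|t eb lb] := hb done z rest sE st2.
    by move=> w; rewrite /st2 !updateE -hst.
  have [] := IH (z :: done) (update st2 0 (Node (g (z :: done)) (st2 0))) sE.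
    split=> [|w wx wy]; rewrite updateE //= /st2 ?st0 //.
    by rewrite !updateE; do 2 case: eqP => //.
  move=> st3 hst3 [t' e' l']; exists st3 => //; eexists.
    apply: exec_While_true e'; first by rewrite /= st0.
    apply: exec_Seq (exec_assign (frefl _) erefl) _.
    apply: exec_Seq (exec_assign (frefl _) erefl) _.
    apply: (@exec_Seq _ _ _ st2) eb.
    apply: exec_assign erefl => w.
    rewrite /st2 /= !updateE /= st0 /=; case: w => //= w;
      rewrite !updateE !eqSS /=.
    do 2 case: eqP => //; move=> wx wy; exact: stw.
  by rewrite /=; lia.
pose st3 := update st 0 (S (g [::]) s).
have [|st4 [st40 st4w] [t e3 l3]] := loop s [::] st3 erefl; first by [].
eexists.
  apply: exec_Seq e1 _; apply: exec_Seq e2 _; apply: (@exec_Seq _ _ _ st3).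
    by apply: exec_assign erefl => w; rewrite /st3 /= !updateE; case: w.
  apply: exec_Seq e3 _; apply: exec_Seq (exec_assign (frefl _) erefl) _.
  apply: exec_Seq (exec_assign (frefl _) erefl) _.
  apply: exec_assign erefl => w.
  rewrite /= !updateE /= st40 /=; case: w => //= w; rewrite !eqSS.
  by case: eqP => [->//|wy]; case: eqP => [->//|wx]; rewrite st4w.
have := leq_mul hL (leqnn (tbound L b + 30)).
by rewrite /=; lia.
Qed.

End Rules.

(** * Polynomial running time of terms *)

Definition poly_bounded (T : nat -> nat) : Prop :=
  exists W D, forall L, T L <= W * L.+1 ^ D.

Lemma poly_boundedC c : poly_bounded (fun=> c).
Proof. by exists c, 0 => L; rewrite expn0 muln1. Qed.

Lemma poly_boundedD T1 T2 :
  poly_bounded T1 -> poly_bounded T2 -> poly_bounded (fun L => T1 L + T2 L).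
Proof.
move=> [W1 [D1 h1]] [W2 [D2 h2]]; exists (W1 + W2), (D1 + D2) => L.
have p1 : L.+1 ^ D1 <= L.+1 ^ (D1 + D2) by rewrite leq_pexp2l //; lia.
have p2 : L.+1 ^ D2 <= L.+1 ^ (D1 + D2) by rewrite leq_pexp2l //; lia.
have := h1 L; have := h2 L; nia.
Qed.

Lemma poly_boundedM T : poly_bounded T -> poly_bounded (fun L => L * T L).
Proof.
move=> [W [D h]]; exists W, D.+1 => L.
by rewrite expnS mulnCA; apply: leq_mul.
Qed.

Lemma tbound_poly e : poly_bounded (tbound^~ e).
Proof.
elim: e => [x||a Ha b Hb|a Ha|a Ha|c Hc a Ha b Hb|x a Ha b Hb|x y l Hl i Hi b
  Hb] /=;
  repeat first [assumption | exact: poly_boundedC | apply: poly_boundedD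
               | apply: poly_boundedM].
Qed.

(** * Derived list operations *)

Definition tR x y l i b := tF x y (tF 0 1 l tN (tC (tV 0) (tV 1))) i b.
Definition tM x l b := tR x 0 l tN (tC b (tV 0)).
Definition tFilter x l b := tR x 0 l tN (tI b (tC (tV x) (tV 0)) (tV 0)).
Definition tCat a b := tR 0 1 a b (tC (tV 0) (tV 1)).
Definition tIter y l i b := tF 0 y l i b.
Definition tDrop l i := tIter 1 l i (tT (tV 1)).
Definition tNth l i := tH (tDrop l i).
Definition tOne := tC tN tN.
Fixpoint tNat n := if n is n'.+1 then tC tN (tNat n') else tN.
Definition tSeq (s : seq tm) := foldr tC tN s.

Lemma enc_natE n : enc_nat n = enc_seq (fun _ : unit => Leaf) (nseq n tt).
Proof. by elim: n => //= n ->. Qed.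

Section Derived.
Variable L : nat.
Implicit Types (r : env) (x y n : nat).

Lemma evals_eq e r v v' : evals L e r v -> v = v' -> evals L e r v'.
Proof. by move=> h <-. Qed.

Lemma evals_R (T : Type) (enc : T -> tree) (g : seq T -> tree) x y l i b r s :
  evals L l r (enc_seq enc s) -> size s <= L -> evals L i r (g [::]) ->
  (forall s1 z s2, s = s1 ++ z :: s2 ->
     evals L b (update (update r x (enc z)) y (g s2)) (g (z :: s2))) ->
  evals L (tR x y l i b) r (g s).
Proof.
move=> hl hL hi hb; rewrite -[s]revK; apply: evals_F hi _; rewrite ?size_rev //.
  apply: (evals_F hl) => // [|s1 z s2 _]; first exact: evals_N.
  by apply: evals_C; apply: evals_V.
move=> s1 z s2 /(congr1 rev); rewrite revK /catrev -/(catrev s1 _) catrevE.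
by rewrite rev_cat revK rev_cons cat_rcons => /hb.
Qed.

Lemma evals_M (T : eqType) (T' : Type) (enc : T -> tree) (enc' : T' -> tree) f
    x l b r s :
  evals L l r (enc_seq enc s) -> size s <= L ->
  (forall z acc, z \in s ->
     evals L b (update (update r x (enc z)) 0 acc) (enc' (f z))) ->
  evals L (tM x l b) r (enc_seq enc' (map f s)).
Proof.
move=> hl hL hb; pose g s := enc_seq enc' (map f s).
apply: (evals_R (g := g) hl) => //; first exact: evals_N.
move=> s1 z s2 sE; apply: evals_C; last exact: evals_V.
by apply: hb; rewrite sE mem_cat mem_head orbT.
Qed.

Lemma evals_filter (T : eqType) (enc : T -> tree) (p : pred T) x l b r s :
  evals L l r (enc_seq enc s) -> size s <= L -> x != 0 ->
  (forall z acc, z \in s ->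
     exists2 v, v <> Leaf <-> p z &
     evals L b (update (update r x (enc z)) 0 acc) v) ->
  evals L (tFilter x l b) r (enc_seq enc (seq.filter p s)).
Proof.
move=> hl hL x0 hb; pose g s := enc_seq enc (seq.filter p s).
apply: (evals_R (g := g) hl) => //; first exact: evals_N.
move=> s1 z s2 sE; have [|v vP hv] := hb z (g s2).
  by rewrite sE mem_cat mem_head orbT.
have zE : enc z = update (update r x (enc z)) 0 (g s2) x.
  by rewrite !updateE eqxx (negPf x0).
rewrite /g /= in zE *; apply: evals_I hv _ _ => [/vP ->|v0].
  by apply: evals_C; rewrite ?[X in evals _ _ _ X]zE; apply: evals_V.
by case: (p z) vP => [[_ /(_ erefl)]//|_]; apply: evals_V.
Qed.

Lemma evals_cat (T : Type) (enc : T -> tree) a b r s1 s2 :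
  evals L a r (enc_seq enc s1) -> size s1 <= L ->
  evals L b r (enc_seq enc s2) ->
  evals L (tCat a b) r (enc_seq enc (s1 ++ s2)).
Proof.
move=> ha hL hb; apply: (evals_R (g := fun s => enc_seq enc (s ++ s2)) ha) =>
  //.
by move=> ? z s _; apply: evals_C; apply: evals_V.
Qed.

Lemma evals_iter (g : nat -> tree) y l i b r n :
  evals L l r (enc_nat n) -> n <= L -> evals L i r (g 0) ->
  (forall j, j < n ->
     evals L b (update (update r 0 Leaf) y (g j)) (g j.+1)) ->
  evals L (tIter y l i b) r (g n).
Proof.
rewrite enc_natE => hl hL hi hb.
have := @evals_F L _ _ (fun s => g (size s)) 0 y l i b r _ hl.
rewrite size_rev !size_nseq; apply=> // s1 z s2 /(congr1 size).
by rewrite size_nseq catrevE size_cat size_rev /= => nE; apply: hb; lia.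
Qed.

Lemma evals_drop l i r n v :
  evals L l r (enc_nat n) -> n <= L -> evals L i r v ->
  evals L (tDrop l i) r (iter n tl v).
Proof.
move=> hl hL hi; apply: (evals_iter (g := fun j => iter j tl v) hl) => // j _.
by apply: evals_T; apply: evals_V.
Qed.

Lemma evals_nth (T : Type) (enc : T -> tree) (z0 : T) l i r n s :
  evals L l r (enc_nat n) -> n <= L -> evals L i r (enc_seq enc s) ->
  enc z0 = Leaf -> evals L (tNth l i) r (enc (nth z0 s n)).
Proof.
move=> hl hL hi z0E; apply: evals_eq (evals_H (evals_drop hl hL hi)) _.
have tl0 j : iter j tl Leaf = Leaf by elim: j => //= j ->.
by elim: n s {hl hL hi} => [|n IH] [|z s] //; rewrite iterSr //= tl0.
Qed.

Lemma evals_nat r n : evals L (tNat n) r (enc_nat n).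
Proof. by elim: n => [|n IH] /=; [apply: evals_N|apply: evals_C IH;
  apply: evals_N]. Qed.

Lemma evals_one r : evals L tOne r (enc_bool true).
Proof. by apply: evals_C; apply: evals_N. Qed.

End Derived.

(** * The reduction *)

Fixpoint bits (n : nat) : seq bitseq :=
  if n is n'.+1 then flatten [seq [:: false :: z; true :: z] | z <- bits n']
  else [:: [::]].

(* [(blk_iter n).1] is [4 ^ (blk_iter n).2], the least such power that is at
   least [n] and has a positive exponent. *)
Definition blk_step (n : nat) (pb : nat * nat) : nat * nat :=
  if pb.1 < n then (4 * pb.1, pb.2.+1) else pb.
Definition blk_iter (n : nat) : nat * nat := iter n (blk_step n) (4, 1).
Definition blk (n : nat) : nat := (blk_iter n).2.

(** Groups start at multiples of b, so in a label of period b the value of variable x is bit x mod b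
    whatever the group: 2^b labels serve all groups. *)
Definition labels (n b : nat) : seq bitseq :=
  [seq iter n (cat y) [::] | y <- bits b].

Definition group_mask (b p : nat) : bitseq := nseq p false ++ nseq b true.
Definition mask_step (n b : nat) (pm : nat * seq bitseq) : nat * seq bitseq :=
  if pm.1 < n then (b + pm.1, group_mask b pm.1 :: pm.2) else pm.
Definition masks (n b : nat) : seq bitseq :=
  (iter n (mask_step n b) (0, [::])).2.

(** Stars and bars: [true] emits the current label and [false] moves on to the next one, so a
    multiset of labels becomes a word whose length is the size of the multiset plus the number of
    labels. *)
Definition dec_step (st : seq bitseq * seq bitseq) (bit : bool) :=
  if bit then (st.1, head [::] st.1 :: st.2) else (behead st.1, st.2).
Definition decode (ls : seq bitseq) (w : bitseq) : seq bitseq :=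
  (foldl dec_step (ls, [::]) w).2.

(* An element of the universe is [(class, (is_row, bits))]: the bits of a row
   tell which variables it represents, those of a column are the values that it
   gives to the variables. *)
Definition elt : Type := (nat * (bool * bitseq))%type.
Definition is_row (u : elt) : bool := u.2.1.
Definition row_el (c : nat) (m : bitseq) : elt := (c, (true, m)).
Definition col_el (c : nat) (l : bitseq) : elt := (c, (false, l)).
(** An empty word reads as [false] everywhere. Hence the filler row is in no clause set, and the
    filler column, alone in class 3, is in those whose fourth slot is [slot_full 0]. *)
Definition row_filler : elt := row_el 0 [::].
Definition col_filler : elt := col_el 3 [::].

Definition layer (ms cs : seq bitseq) (c : nat) : seq elt :=
  flatten [seq [:: col_filler; row_el c m] | m <- ms] ++
  flatten [seq [:: col_el c l; row_filler] | l <- cs].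
(** Layers are balanced between rows and columns. The first three elements give the rows an excess
    of one, and ensure that there is a column, hence at least one constraint, even when [ms] and
    [cs] are empty. *)
Definition universe (ms cs : seq bitseq) : seq elt :=
  [:: row_filler; col_filler; row_filler] ++
  (layer ms cs 0 ++ (layer ms cs 1 ++ (layer ms cs 2 ++ [::]))).

(* The slot [Some (x, (s1, s0))] of a clause concerns variable [x] in the class
   given by the position of the slot; [s1] and [s0] tell whether the values
   [true] and [false] of [x] satisfy the clause. *)
Definition slot : Type := option (nat * (bool * bool)).
Definition hits (G : seq slot) (u : elt) : bool :=
  if nth None G u.1 is Some xp then
    let v := nth false u.2.2 xp.1 in
    if is_row u then v else if v then xp.2.1 else xp.2.2
  else false.

Definition slot_none (x : nat) : slot := Some (x, (false, false)).
Definition slot_full (x : nat) : slot := Some (x, (true, true)).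
Definition slot_lit (x : nat) (s : bool) : slot := Some (x, (s, ~~ s)).

(** For each of the three copies, one set asks for a filler column beside the row of [x] and another
    for a column of that copy. The last three sets are the implications x0 -> x1 -> x2 -> x0 between
    the values in the copies. *)
Definition var_clauses (x : nat) : seq (seq slot) :=
  [:: [:: slot_none x; None; None; slot_full 0];
      [:: None; slot_none x; None; slot_full 0];
      [:: None; None; slot_none x; slot_full 0];
      [:: slot_full x];
      [:: None; slot_full x];
      [:: None; None; slot_full x];
      [:: slot_lit x false; slot_lit x true];
      [:: None; slot_lit x false; slot_lit x true];
      [:: slot_lit x true; None; slot_lit x false]].

Definition phi_clauses (n : nat) (phi : cnf n) : seq (seq slot) :=
  [seq [seq slot_lit (val l.1) l.2 | l <- C] | C <- phi].

Definition clauses (n : nat) (phi : cnf n) : seq (seq slot) :=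
  flatten [seq var_clauses x | x <- rev (iota 0 n)] ++ phi_clauses phi.

(** Rows outnumber columns by one, so the number of rows is the smallest majority, and a majority
    without a column is the set of all rows. *)
Definition is_big (U : seq elt) (X : bitseq) : bool :=
  (size (seq.filter is_row U) <= count id X) &&
  has (fun p => ~~ is_row p.1 && p.2) (zip U X).

Definition cp_sets (U : seq elt) (Gs : seq (seq slot)) : seq bitseq :=
  [seq X <- bits (size U) | is_big U X] ++
  [seq [seq hits G u | u <- U] | G <- Gs].

Definition universe_of (n : nat) (w : bitseq) : seq elt :=
  universe (masks n (blk n)) (decode (labels n (blk n)) w).

(** The multiset has one label per group, which fixes the length of the word. *)
Definition guesses (n : nat) : seq bitseq :=
  bits (size (masks n (blk n) ++ labels n (blk n))).

Definition instance (n : nat) (phi : cnf n) (w : bitseq) : nat * seq bitseq :=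
  (size (universe_of n w), cp_sets (universe_of n w) (clauses phi)).

(** * The reduction as a program *)

Notation enc_bits := (enc_seq enc_bool).
Definition enc_elt (u : elt) : tree :=
  Node (enc_nat u.1) (Node (enc_bool u.2.1) (enc_bits u.2.2)).
Definition enc_slot (s : slot) : tree :=
  if s is Some xp then
    Node (enc_nat xp.1) (Node (enc_bool xp.2.1) (enc_bool xp.2.2))
  else Leaf.
Definition enc_instance (I : nat * seq bitseq) : tree :=
  Node (enc_nat I.1) (enc_seq enc_bits I.2).

Local Notation vIn := 2.
Local Notation vN := 3.
Local Notation vPhi := 4.
Local Notation vB := 5.
Local Notation vLabels := 6.
Local Notation vMasks := 7.
Local Notation vClauses := 8.
Local Notation vW := 9.
Local Notation vCols := 10.
Local Notation vU := 11.
Local Notation vRows := 12.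

Definition tBits (l : tm) : tm :=
  tR 0 1 l (tC tN tN)
    (tR 2 3 (tV 1) tN (tC (tC tN (tV 2)) (tC (tC tOne (tV 2)) (tV 3)))).

Definition tQuadruple (a : tm) : tm := tCat a (tCat a (tCat a (tCat a tN))).

Definition tBlk : tm :=
  tT (tIter 20 (tV vN) (tC (tNat 4) (tNat 1))
    (tI (tDrop (tH (tV 20)) (tV vN))
        (tC (tQuadruple (tH (tV 20))) (tC tN (tT (tV 20))))
        (tV 20))).

Definition tLabels : tm :=
  tM 20 (tBits (tV vB)) (tIter 21 (tV vN) tN (tCat (tV 20) (tV 21))).

Definition tMask (p : tm) : tm :=
  tR 0 1 p (tR 0 1 (tV vB) tN (tC tOne (tV 1))) (tC tN (tV 1)).

Definition tMasks : tm :=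
  tT (tIter 20 (tV vN) (tC tN tN)
    (tI (tDrop (tH (tV 20)) (tV vN))
        (tC (tCat (tV vB) (tH (tV 20))) (tC (tMask (tH (tV 20))) (tT (tV 20))))
        (tV 20))).

Definition tPhi : tm :=
  tM 20 (tV vPhi) (tM 21 (tV 20)
    (tC (tH (tV 21)) (tI (tT (tV 21)) (tC tOne tN) (tC tN tOne)))).

Definition tVarClauses (x : tm) (rest : tm) : tm :=
  let none := tC x (tC tN tN) in
  let full x := tC x (tC tOne tOne) in
  let pos := tC x (tC tOne tN) in
  let neg := tC x (tC tN tOne) in
  foldr tC rest
    [:: tSeq [:: none; tN; tN; full tN];
        tSeq [:: tN; none; tN; full tN];
        tSeq [:: tN; tN; none; full tN];
        tSeq [:: full x];
        tSeq [:: tN; full x];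
        tSeq [:: tN; tN; full x];
        tSeq [:: neg; pos];
        tSeq [:: tN; neg; pos];
        tSeq [:: pos; tN; neg]].

Definition tClauses : tm :=
  tT (tIter 20 (tV vN) (tC tN tPhi)
    (tC (tC tN (tH (tV 20))) (tVarClauses (tH (tV 20)) (tT (tV 20))))).

Definition tDecode : tm :=
  tT (tF 20 21 (tV vW) (tC (tV vLabels) tN)
    (tI (tV 20)
      (tC (tH (tV 21)) (tC (tH (tH (tV 21))) (tT (tV 21))))
      (tC (tT (tH (tV 21))) (tT (tV 21))))).

Definition tElt (c : nat) (r bs : tm) : tm := tC (tNat c) (tC r bs).
Definition tRowFiller : tm := tElt 0 tOne tN.
Definition tColFiller : tm := tElt 3 tN tN.

Definition tLayer (c : nat) (rest : tm) : tm :=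
  tR 20 21 (tV vMasks)
    (tR 20 21 (tV vCols) rest (tC (tElt c tN (tV 20)) (tC tRowFiller (tV 21))))
    (tC tColFiller (tC (tElt c tOne (tV 20)) (tV 21))).

Definition tUniverse : tm :=
  foldr tC (tLayer 0 (tLayer 1 (tLayer 2 tN)))
    [:: tRowFiller; tColFiller; tRowFiller].

Definition tRows : tm := tFilter 20 (tV vU) (tH (tT (tV 20))).

(** Each element of the set cancels one row, so the result is nil exactly when the set has at least
    as many elements as there are rows. *)
Definition tLarge : tm :=
  tF 21 22 (tV 20) (tV vRows) (tI (tV 21) (tT (tV 22)) (tV 22)).

Definition tMeets : tm :=
  tT (tF 21 22 (tV vU) (tC (tV 20) tN)
    (tC (tT (tH (tV 22)))
        (tI (tH (tH (tV 22))) (tI (tH (tT (tV 21))) (tT (tV 22)) tOne)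
            (tT (tV 22))))).

Definition tFamily : tm := tFilter 20 (tBits (tV vU)) (tI tLarge tN tMeets).

Definition tHits : tm :=
  tL 22 (tNth (tH (tV 21)) (tV 20))
    (tI (tV 22)
      (tL 23 (tNth (tH (tV 22)) (tT (tT (tV 21))))
        (tI (tH (tT (tV 21))) (tV 23)
          (tI (tV 23) (tH (tT (tV 22))) (tT (tT (tV 22))))))
      tN).

Definition tClauseSets : tm := tM 20 (tV vClauses) (tM 21 (tV vU) tHits).

Definition tSize (l : tm) : tm := tR 0 1 l tN (tC tN (tV 1)).

Definition tInstance : tm :=
  tL vCols tDecode
  (tL vU tUniverse
  (tL vRows tRows
  (tC (tSize (tV vU)) (tCat tFamily tClauseSets)))).

Definition tInstances : tm :=
  tL vN (tH (tV vIn))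
  (tL vPhi (tT (tV vIn))
  (tL vB tBlk
  (tL vLabels tLabels
  (tL vMasks tMasks
  (tL vClauses tClauses
  (tM vW (tBits (tCat (tV vMasks) (tV vLabels))) tInstance)))))).

(** * Correctness of the program *)

Section Correctness.
Variable L : nat.

Lemma evals_V' x r v : r x = v -> evals L (tV x) r v.
Proof. by move=> <-; apply: evals_V. Qed.

Lemma evals_If c a b r (x : bool) y :
  evals L c r (enc_bool x) -> (x -> evals L a r y) -> (~~ x -> evals L b r y) ->
  evals L (tI c a b) r y.
Proof.
move=> hc ha hb; apply: evals_I hc _ _; case: x ha hb => // ha hb _.
  exact: ha.
exact: hb.
Qed.

Lemma evals_H' a r x y : evals L a r (Node x y) -> evals L (tH a) r x.
Proof. exact: evals_H. Qed.

Lemma evals_T' a r x y : evals L a r (Node x y) -> evals L (tT a) r y.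
Proof. exact: evals_T. Qed.

Lemma iter_tl_nat p n : iter p tl (enc_nat n) = enc_nat (n - p).
Proof. by elim: p => [|p IH]; rewrite ?subn0 // iterS IH subnS;
  case: (n - p). Qed.

Lemma size_bits n : size (bits n) = 2 ^ n.
Proof.
have E (S : seq bitseq) :
    size (flatten [seq [:: false :: z; true :: z] | z <- S]) = 2 * size S.
  by elim: S => //= z S ->; lia.
by elim: n => //= n IH; rewrite E IH expnS.
Qed.

Lemma size_mem_bits n z : z \in bits n -> size z = n.
Proof.
elim: n z => [|n IH] z /=; first by rewrite inE => /eqP ->.
by case/flattenP=> S /mapP[y /IH yn ->]; rewrite !inE => /orP[]/eqP -> /=;
  rewrite yn.
Qed.

Local Ltac ev := repeat first
  [ exact: evals_V' | apply: evals_V'; eassumption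
  | exact: evals_N | exact: evals_one | exact: evals_nat
  | apply: evals_C | apply: evals_H' | apply: evals_T' ].

Lemma evals_bits (T : Type) (enc : T -> tree) l r s :
  evals L l r (enc_seq enc s) -> 2 ^ size s <= L ->
  evals L (tBits l) r (enc_seq enc_bits (bits (size s))).
Proof.
move=> hl hL; have sL := leq_trans (ltnW (ltn_expl (size s) (ltnSn 1))) hL.
pose g s := enc_seq enc_bits (bits (size (s : seq T))).
apply: (evals_R (g := g) hl) => // [|s1 z s2 sE].
  by apply: evals_C; apply: evals_N.
pose g2 S := enc_seq enc_bits
  (flatten [seq [:: false :: z; true :: z] | z <- S]).
apply: (evals_R (enc := enc_bits) (g := g2) (s := bits (size s2))).
- exact: evals_V'.
- rewrite size_bits (leq_trans _ hL) // leq_pexp2l // sE size_cat /=; lia.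
- exact: evals_N.
- by move=> s3 w s4 _; ev.
Qed.

Lemma evals_blk r n :
  r vN = enc_nat n -> 4 * n + 4 <= L -> evals L tBlk r (enc_nat (blk n)).
Proof.
move=> rN hL; pose g j := let pb := iter j (blk_step n) (4, 1) in
  Node (enc_nat pb.1) (enc_nat pb.2).
(* The power is multiplied by 4 only while it is below [n]. *)
have small j : (iter j (blk_step n) (4, 1)).1 <= 4 * n + 4.
  elim: j => //= [|j IH]; first lia.
  by rewrite /blk_step; case: ltnP => //=; lia.
apply: evals_T'; apply: (evals_iter (g := g)); first exact: evals_V'.
- lia.
- rewrite /g [iter 0 _ _]/=; apply: evals_C; exact: evals_nat.
move=> j _; rewrite /g iterS; set pb := iter j _ _; have := small j;
  rewrite -/pb.
move=> pbL; rewrite /blk_step.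
apply: (@evals_I _ _ _ _ _ (enc_nat (n - pb.1))).
- by rewrite -iter_tl_nat; apply: evals_drop; [ev | lia | ev].
- case: ltnP => [lt _|le];
  last by rewrite (eqP (_ : n - pb.1 == 0)) // subn_eq0.
  apply: evals_C; last by ev.
  rewrite !enc_natE (_ : 4 * pb.1 = pb.1 + (pb.1 + (pb.1 + (pb.1 + 0))));
    last lia.
  rewrite !nseqD; do 4 (apply: evals_cat; rewrite ?size_nseq;
    [by rewrite -enc_natE; ev|lia|]).
  exact: evals_N.
- case: ltnP => [|_ _]; last exact: evals_V'.
  by rewrite -subn_gt0; case: (n - pb.1).
Qed.

Lemma evals_labels r n b :
  r vN = enc_nat n -> r vB = enc_nat b -> n <= L -> b <= L -> 2 ^ b <= L ->
  evals L tLabels r (enc_seq enc_bits (labels n b)).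
Proof.
move=> rN rB nL bL hL; apply: (evals_M (enc := enc_bits)).
- have -> : bits b = bits (size (nseq b tt)) by rewrite size_nseq.
  apply: (evals_bits (enc := fun=> Leaf)); rewrite ?size_nseq //.
  by rewrite -enc_natE; ev.
- by rewrite size_bits.
move=> y acc yb; pose g j := enc_bits (iter j (cat y) [::]).
apply: (evals_iter (g := g)) => //; [by ev | by ev |].
move=> j _; rewrite /g /=; apply: evals_cat; [by ev| |by ev].
by rewrite (size_mem_bits yb).
Qed.

Lemma evals_mask p r j b :
  r vB = enc_nat b -> evals L p r (enc_nat j) -> j <= L -> b <= L ->
  evals L (tMask p) r (enc_bits (group_mask b j)).
Proof.
rewrite !enc_natE => rB hp jL bL.
have := @evals_R L _ _ (fun s => enc_bits (nseq (size s) false ++ nseq b true))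
  0 1
  _ (tR 0 1 (tV vB) tN (tC tOne (tV 1))) (tC tN (tV 1)) _ _ hp.
rewrite !size_nseq; apply=> // [|s1 z s2 _]; last by ev.
have := @evals_R L _ _ (fun s => enc_bits (nseq (size s) true)) 0 1
  (tV vB) tN (tC tOne (tV 1)) r (nseq b tt) (evals_V' rB).
by rewrite !size_nseq; apply=> // [|s1 z s2 _]; ev.
Qed.

Lemma evals_masks r n b :
  r vN = enc_nat n -> r vB = enc_nat b -> n + b <= L ->
  evals L tMasks r (enc_seq enc_bits (masks n b)).
Proof.
move=> rN rB hL; pose g j := let pm := iter j (mask_step n b) (0, [::]) in
  Node (enc_nat pm.1) (enc_seq enc_bits pm.2).
have small j : (iter j (mask_step n b) (0, [::])).1 <= n + b.
  elim: j => //= j IH.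
  by rewrite /mask_step; case: ltnP => //=; lia.
apply: evals_T'; apply: (evals_iter (g := g)); first exact: evals_V'.
- lia.
- by ev.
move=> j _; rewrite /g iterS; set pb := iter j _ _; have := small j;
  rewrite -/pb.
move=> pbL; rewrite /mask_step.
apply: (@evals_I _ _ _ _ _ (enc_nat (n - pb.1))).
- by rewrite -iter_tl_nat; apply: evals_drop; [ev | lia | ev].
- case: ltnP => [lt _|le];
  last by rewrite (eqP (_ : n - pb.1 == 0)) // subn_eq0.
  apply: evals_C.
    rewrite !enc_natE nseqD; apply: evals_cat; rewrite ?size_nseq -?enc_natE;
      by [ev|lia].
  apply: evals_C; last by ev.
  by apply: evals_mask; [|ev|lia|lia].
- case: ltnP => [|_ _]; last exact: evals_V'.
  by rewrite -subn_gt0; case: (n - pb.1).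
Qed.

Lemma evals_phi r n (phi : cnf n) :
  r vPhi = enc_seq (enc_seq (@enc_literal n)) phi -> size phi <= L ->
  all (fun C => size C <= L) phi ->
  evals L tPhi r (enc_seq (enc_seq enc_slot) (phi_clauses phi)).
Proof.
move=> rP pL /allP CL; apply: (evals_M (enc := enc_seq (@enc_literal n))) pL _.
  exact: evals_V'.
move=> C acc /CL {}CL; apply: (evals_M (enc := @enc_literal n)) CL _.
  exact: evals_V'.
move=> [x s] acc' _; apply: evals_C; first by ev.
by apply: (evals_If (x := s)); [ev | case: s => // _; ev | case: s => // _; ev].
Qed.

Lemma evals_clauses r n (phi : cnf n) :
  r vN = enc_nat n -> r vPhi = enc_seq (enc_seq (@enc_literal n)) phi ->
  n <= L -> size phi <= L -> all (fun C => size C <= L) phi ->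
  evals L tClauses r (enc_seq (enc_seq enc_slot) (clauses phi)).
Proof.
move=> rN rP nL pL CL; pose g j := Node (enc_nat j) (enc_seq (enc_seq enc_slot)
  (flatten [seq var_clauses x | x <- rev (iota 0 j)] ++ phi_clauses phi)).
apply: evals_T'; apply: (evals_iter (g := g)) => //.
- by ev.
- by apply: evals_C; [ev | exact: evals_phi].
move=> j _; rewrite /g -{2}[j.+1]addn1 iotaD rev_cat /=.
by ev.
Qed.

Lemma evals_decode r ls w :
  r vLabels = enc_seq enc_bits ls -> r vW = enc_bits w -> size w <= L ->
  evals L tDecode r (enc_seq enc_bits (decode ls w)).
Proof.
move=> rL rW wL; pose g s := let st := foldl dec_step (ls, [::]) (rev s) in
  Node (enc_seq enc_bits st.1) (enc_seq enc_bits st.2).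
apply: evals_T'; rewrite /decode -[X in foldl _ _ X]revK.
apply: (evals_F (enc := enc_bool) (g := g)) wL _ _; first exact: evals_V'.
  by ev.
move=> s1 z s2 _; rewrite /g rev_cons foldl_rcons; set st := foldl _ _ _.
apply: (evals_If (x := z)); first by ev.
  case: z => // _; rewrite /dec_step /=; apply: evals_C; first by ev.
  apply: evals_C; last by ev.
  apply: evals_eq; first by apply: evals_H; ev.
  by case: st.1.
case: z => // _; rewrite /dec_step /=; apply: evals_C; last by ev.
apply: evals_eq; first by apply: evals_T; ev.
by case: st.1.
Qed.

Lemma evals_layer r ms cs c rest U :
  r vMasks = enc_seq enc_bits ms -> r vCols = enc_seq enc_bits cs ->
  size ms <= L -> size cs <= L ->
  evals L rest r (enc_seq enc_elt U) ->
  evals L (tLayer c rest) r (enc_seq enc_elt (layer ms cs c ++ U)).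
Proof.
move=> rM rC mL cL hr; rewrite /layer -catA; set U' := _ ++ U.
pose g s := enc_seq enc_elt
  (flatten [seq [:: col_filler; row_el c m] | m <- s] ++ U').
apply: (evals_R (enc := enc_bits) (g := g)) mL _ _; first exact: evals_V'.
  pose g' s := enc_seq enc_elt
    (flatten [seq [:: col_el c l; row_filler] | l <- s] ++ U).
  apply: (evals_R (enc := enc_bits) (g := g')) cL _ _ => //;
    first exact: evals_V'.
  by move=> s1 z s2 _; ev.
move=> s1 z s2 _; rewrite /g /=; apply: evals_C; last by ev.
by apply: evals_C; [exact: (@evals_nat L _ 3) | ev].
Qed.

Lemma evals_universe r ms cs :
  r vMasks = enc_seq enc_bits ms -> r vCols = enc_seq enc_bits cs ->
  size ms <= L -> size cs <= L ->
  evals L tUniverse r (enc_seq enc_elt (universe ms cs)).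
Proof.
move=> rM rC mL cL; rewrite /universe /= /tColFiller /tRowFiller.
apply: evals_C; first by ev.
apply: evals_C; first by apply: evals_C; [exact: (@evals_nat L _ 3) | ev].
apply: evals_C; first by ev.
do 3 apply: evals_layer => //; exact: evals_N.
Qed.

Lemma evals_rows r U :
  r vU = enc_seq enc_elt U -> size U <= L ->
  evals L tRows r (enc_seq enc_elt (seq.filter is_row U)).
Proof.
move=> rU UL; apply: evals_filter UL _ _ => //; first exact: evals_V'.
move=> [c [b bs]] acc _; exists (enc_bool b); first by case: b; split.
by ev.
Qed.

Lemma evals_large r X rows :
  r 20 = enc_bits X -> r vRows = enc_seq enc_elt rows -> size X <= L ->
  evals L tLarge r (enc_seq enc_elt (drop (count id X) rows)).
Proof.
move=> rX rR XL; rewrite -[in count _ _](revK X) (count_rev id).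
apply: (evals_F (enc := enc_bool)
  (g := fun s => enc_seq enc_elt (drop (count id s) rows))) XL _ _.
- exact: evals_V'.
- by rewrite drop0; ev.
move=> s1 z s2 _; apply: (evals_If (x := z)); first (by ev); case: z => // _;
  last by ev.
apply: evals_eq; first by apply: evals_T; ev.
by rewrite /= -drop_drop; case: (drop _ rows) => // u s; rewrite /= drop0.
Qed.

Lemma has_zip_rcons (T : Type) (p : T * bool -> bool) s z X :
  size s < size X ->
  has p (zip (rcons s z) X) = has p (zip s X) || p (z, nth false X (size s)).
Proof.
elim: s X => [|y s IH] X; first by case: X => [|b [|b' X]] //= _; rewrite orbF.
by case: X => [|b X] //= /IH ->; rewrite orbA.
Qed.

Lemma evals_meets r X U :
  r 20 = enc_bits X -> r vU = enc_seq enc_elt U -> size X = size U ->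
  size U <= L ->
  evals L tMeets r (enc_bool (has (fun p => ~~ is_row p.1 && p.2) (zip U X))).
Proof.
move=> rX rU XU UL; set p := fun _ => _.
(* The state consists of the unread bits of [X] and the verdict on the prefix already read. *)
pose g s := Node (enc_bits (drop (size s) X)) (enc_bool (has p (zip (rev s)
  X))).
apply: evals_T'; rewrite -[in zip _ _](revK U).
apply: (evals_F (enc := enc_elt) (g := g)) UL _ _.
- exact: evals_V'.
- by rewrite /g drop0 (_ : zip _ _ = [::]); [ev | case: (X)].
move=> s1 z s2 UE; have sX : size s1 < size X.
  by rewrite XU UE catrevE size_cat size_rev /=; lia.
rewrite /g rev_cons has_zip_rcons ?size_rev // (drop_nth false sX).
apply: evals_C; first by ev.
apply: (evals_If (x := nth false X (size s1))); first by ev.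
  rewrite /p /=; case: nth => // _.
  apply: (evals_If (x := z.2.1)); first by ev.
    by rewrite /is_row; case: z.2.1 => // _; rewrite orbF; ev.
  by rewrite /is_row; case: z.2.1 => // _; rewrite orbT; ev.
by rewrite /p /=; case: nth => // _; rewrite andbF orbF; ev.
Qed.

Lemma evals_family r U :
  r vU = enc_seq enc_elt U -> r vRows = enc_seq enc_elt (seq.filter is_row U) ->
  2 ^ size U <= L ->
  evals L tFamily r (enc_seq enc_bits [seq X <- bits (size U) | is_big U X]).
Proof.
move=> rU rR UL; have sL := leq_trans (ltnW (ltn_expl (size U) (ltnSn 1))) UL.
apply: evals_filter => //; last first.
- move=> X acc /size_mem_bits XU.
  have hl := @evals_large (update (update r 20 (enc_bits X)) 0 acc) X _ erefl
    rR.
  rewrite XU in hl; have {}hl := hl sL.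
  have hm := @evals_meets (update (update r 20 (enc_bits X)) 0 acc) X U erefl
    rU XU sL.
  case: (leqP (size (seq.filter is_row U)) (count id X)) => hc.
    exists (enc_bool (has (fun p => ~~ is_row p.1 && p.2) (zip U X))).
      by rewrite /is_big hc /=; case: has; split.
    by apply: evals_I hl _ _; rewrite drop_oversize.
  exists Leaf; first by rewrite /is_big leqNgt hc.
  apply: evals_I hl _ _ => [_|]; first exact: evals_N.
  by rewrite (drop_nth row_filler hc).
- by rewrite size_bits.
- exact: (evals_bits (evals_V' rU) UL).
Qed.

(** [tNth] loops over a unary index, so classes and variable numbers have to be at most [L] as
    well. *)
Lemma evals_hits r G u :
  r 20 = enc_seq enc_slot G -> r 21 = enc_elt u -> u.1 <= L ->
  all (fun s => if s is Some xp then xp.1 <= L else true) G ->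
  evals L tHits r (enc_bool (hits G u)).
Proof.
move=> rG ru uL /allP GL.
apply: evals_L.
  by apply: (evals_nth (enc := enc_slot) (z0 := None) (s := G) _ uL);
    [ev | ev |].
rewrite /hits; case gE: (nth None G u.1) => [[x p]|]; last first.
  by apply: evals_I; [ev | by [] | move=> _; ev].
have xL : x <= L.
  have [lt|le] := ltnP u.1 (size G); last by rewrite nth_default in gE.
  by apply: (GL (Some (x, p))); rewrite -gE mem_nth.
apply: (@evals_I _ _ _ _ _ (enc_slot (Some (x, p)))) => [|_|//]; first by ev.
apply: evals_L.
  by apply: (evals_nth (enc := enc_bool) (z0 := false) (s := u.2.2) _ xL);
    [ev | ev |].
apply: (evals_If (x := u.2.1)); first by ev.
  by rewrite /is_row; case: u.2.1 => // _; ev.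
rewrite /is_row; case: u.2.1 => // _.
apply: (evals_If (x := nth false u.2.2 x)); first by ev.
  by case: (nth false _ _) => // _; ev.
by case: (nth false _ _) => // _; ev.
Qed.

Lemma evals_clause_sets r Gs U :
  r vClauses = enc_seq (enc_seq enc_slot) Gs -> r vU = enc_seq enc_elt U ->
  size Gs <= L -> size U <= L -> all (fun u : elt => u.1 <= L) U ->
  all (all (fun s : slot => if s is Some xp then xp.1 <= L else true)) Gs ->
  evals L tClauseSets r
    (enc_seq enc_bits [seq [seq hits G u | u <- U] | G <- Gs]).
Proof.
move=> rG rU GL UL /allP uL /allP xL.
apply: (evals_M (enc := enc_seq enc_slot) (f := fun G => map (hits G) U)) GL _.
  exact: evals_V'.
move=> G acc /xL {}xL; apply: (evals_M (enc := enc_elt)) UL _.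
  exact: evals_V'.
by move=> u acc' /uL {}uL; apply: evals_hits.
Qed.

Lemma evals_size (T : Type) (enc : T -> tree) l r s :
  evals L l r (enc_seq enc s) -> size s <= L ->
  evals L (tSize l) r (enc_nat (size s)).
Proof.
move=> hl sL; apply: (evals_R (g := fun s => enc_nat (size s)) hl sL).
  exact: evals_N.
by move=> ? ? ? _; ev.
Qed.

Lemma universe_class ms cs : all (fun u : elt => u.1 <= 3) (universe ms cs).
Proof.
have lay c : c <= 3 -> all (fun u : elt => u.1 <= 3) (layer ms cs c).
  move=> c3; rewrite /layer all_cat.
  by apply/andP; split; [elim: ms | elim: cs] => //= ? ? ->; rewrite c3.
by rewrite /universe !all_cat; apply/and5P; split=> //; rewrite -all_cat;
  apply: lay.
Qed.

Lemma size_layer ms cs c : size (layer ms cs c) = 2 * size ms + 2 * size cs.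
Proof.
rewrite /layer size_cat; congr addn; [elim: ms | elim: cs] => //= ? ? ->; lia.
Qed.

Lemma size_universe ms cs : size (universe ms cs) = 3 + 6 * (size ms + size cs).
Proof.
rewrite /universe; have := size_layer ms cs; move: (layer ms cs) => lay sz.
by rewrite !size_cat !sz /=; lia.
Qed.

Lemma clauses_vars n (phi : cnf n) :
  all (all (fun s : slot => if s is Some xp then xp.1 <= n else true))
    (clauses phi).
Proof.
rewrite all_cat; apply/andP; split.
  apply/allP => G /flattenP[Gs /mapP[x]].
  rewrite mem_rev mem_iota /= => /ltnW xn -> /=.
  by rewrite !inE =>
    /or4P[/eqP->|/eqP->|/eqP->|/or4P[/eqP->|/eqP->|/eqP->|/or3P[]/eqP->]] /=;
    rewrite ?xn ?leq0n.
by rewrite all_map; apply/allP => C _; rewrite /= all_map;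
  apply/allP => -[x s] _ /=;
  rewrite ltnW.
Qed.

(** From these bounds it follows that every list folded over, unary numbers included, has length at
    most [L]. *)
Definition fits (n : nat) (phi : cnf n) : Prop :=
  [/\ 4 * n + 4 <= L, n + blk n <= L, 2 ^ blk n <= L
    & 2 ^ size (masks n (blk n) ++ labels n (blk n)) <= L] /\
  [/\ forall w, w \in guesses n -> 2 ^ size (universe_of n w) <= L,
      size phi <= L, all (fun C => size C <= L) phi & size (clauses phi) <= L].

Lemma evals_instance r n (phi : cnf n) w :
  fits phi -> w \in guesses n ->
  r vLabels = enc_seq enc_bits (labels n (blk n)) ->
  r vMasks = enc_seq enc_bits (masks n (blk n)) ->
  r vClauses = enc_seq (enc_seq enc_slot) (clauses phi) ->
  r vW = enc_bits w ->
  evals L tInstance r (enc_instance (instance phi w)).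
Proof.
move=> [[nL _ _ gL] [UL _ _ cL]] wg rL rM rC rW.
have {}UL := UL w wg; have {}gL := leq_trans (ltnW (ltn_expl _ (ltnSn 1))) gL.
have sUL := leq_trans (ltnW (ltn_expl _ (ltnSn 1))) UL.
have [sM sC] : size (masks n (blk n)) <= L /\
    size (decode (labels n (blk n)) w) <= L.
  by move: sUL; rewrite size_universe; lia.
apply: evals_L.
  by apply: evals_decode rL rW _; rewrite (size_mem_bits wg).
apply: evals_L; first by apply: evals_universe sM sC; ev.
rewrite -/(universe_of n w).
apply: evals_L; first exact: evals_rows.
apply: evals_C; first exact: (evals_size (evals_V' _)).
apply: evals_cat; first exact: evals_family.
  by rewrite (leq_trans _ UL) // size_filter -size_bits count_size.
apply: (evals_clause_sets (Gs := clauses phi) (U := universe_of n w)) => //.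
  apply: sub_all (universe_class _ _) => u /leq_trans; apply; lia.
apply: sub_all (clauses_vars phi) => G; apply: sub_all => -[[x p]|] //=; lia.
Qed.

Lemma evals_instances r n (phi : cnf n) :
  fits phi -> r vIn = enc_cnf phi ->
  evals L tInstances r
    (enc_seq enc_instance [seq instance phi w | w <- guesses n]).
Proof.
move=> hf rI; have [[nL bL BL gL] [UL pL CL cL]] := hf.
apply: (@evals_L _ _ _ _ _ (enc_nat n)); first by ev.
apply: (@evals_L _ _ _ _ _ (enc_seq (enc_seq (@enc_literal n)) phi)).
  apply: evals_T'; apply: evals_V'; exact: rI.
apply: evals_L; first exact: evals_blk.
apply: evals_L; first by apply: evals_labels => //; lia.
apply: evals_L; first exact: evals_masks.
apply: evals_L; first by apply: evals_clauses => //; lia.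
apply: (evals_M (enc := enc_bits)).
- apply: (evals_bits (enc := enc_bits) _ gL).
  apply: evals_cat; [by ev | | by ev].
  by apply: leq_trans gL; rewrite (leq_trans _ (ltnW (ltn_expl _ (ltnSn 1))))
    // size_cat leq_addr.
- by rewrite size_bits.
by move=> w acc wg; apply: evals_instance.
Qed.

End Correctness.

(** * Running the solver on every instance *)

Fixpoint expr_vars (e : expr) : nat :=
  match e with
  | Var v => v.+1
  | Nil => 0
  | Cons a b => maxn (expr_vars a) (expr_vars b)
  | Hd a | Tl a => expr_vars a
  end.

Fixpoint prog_vars (p : program) : nat :=
  match p with
  | Assign v e => maxn v.+1 (expr_vars e)
  | Seq p q => maxn (prog_vars p) (prog_vars q)
  | If e p q => maxn (expr_vars e) (maxn (prog_vars p) (prog_vars q))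
  | While e p => maxn (expr_vars e) (prog_vars p)
  end.

Lemma eval_agree e n (s r : store) :
  expr_vars e <= n -> (forall v, v < n -> s v = r v) -> eval s e = eval r e.
Proof.
move=> + sr; elim: e => [v||a IHa b IHb|a IHa|a IHa] //=; first exact: sr.
- by rewrite geq_max => /andP[/IHa -> /IHb ->].
- by move=> /IHa ->.
- by move=> /IHa ->.
Qed.

Definition overwrite (n : nat) (r s : store) : store :=
  fun v => if v < n then s v else r v.

(** This lets the solver run inside a loop: variables from [n] on, which hold the state of the loop,
    do not influence it and survive it. *)
Lemma exec_frame p n s s' t r : exec p s s' t -> prog_vars p <= n ->
  exec p (overwrite n r s) (overwrite n r s') t.
Proof.
have ev e s1 : expr_vars e <= n -> eval (overwrite n r s1) e = eval s1 e.
  by move=> en; apply: eval_agree en _ => v vn; rewrite /overwrite vn.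
elim=> {p s s' t} [v e s|p q s1 s2 s3 t u _ IH1 _ IH2|e p q s1 s2 t h _ IH
  |e p q s1 s2 t h _ IH|e p s1 s2 s3 t u h e1 IH1 e2 IH2|e p s h] /=;
  rewrite ?geq_max.
- case/andP=> vn en; apply: exec_assign => // w.
  by rewrite !updateE /overwrite !updateE ev //; case: eqP => // ->; rewrite vn.
- by case/andP=> p1 p2; apply: exec_Seq (IH1 p1) (IH2 p2).
- by case/and3P=> en p1 p2; apply: exec_If_true (IH p1); rewrite ev.
- by case/and3P=> en p1 p2; apply: exec_If_false (IH p2); rewrite ev.
- move=> h2; case/andP: (h2) => en p1.
  by apply: exec_While_true (IH1 p1) (IH2 _); rewrite ?ev //= geq_max en.
- by case/andP=> en p1; apply: exec_While_false; rewrite ev.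
Qed.

Fixpoint clear (n : nat) : program :=
  if n is n'.+1 then clear n' ;; Assign n' Nil else Assign 0 Nil.

Lemma exec_clear n s :
  exec (clear n.+1) s (overwrite n.+1 s (fun=> Leaf)) (2 * n + 4).
Proof.
elim: n => [|n IH].
  apply: exec_Seq (exec_Assign _ _ _) _; apply: exec_assign => // w.
  by rewrite !updateE /overwrite ltnS leqn0; case: eqP.
apply: exec_eq (exec_Seq IH (exec_Assign _ _ _)) _ _; last by rewrite /=; lia.
move=> w; rewrite !updateE /overwrite [in RHS]ltnS [in RHS]leq_eqVlt.
by case: eqP.
Qed.

Section Loop.
Variable p : program.

Definition vlist : nat := (prog_vars p).+1.

(** [runs] starts from a blank store, so the variables of the solver are cleared in each round. The
    pending instances and the disjunction of the answers are kept in the two variables [vlist] and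
    [vlist.+1], beyond its reach. *)
Definition solve_all : program :=
  While (Var vlist)
    (clear vlist ;;
     Assign 0 (Hd (Var vlist)) ;;
     p ;;
     If (Var 0) (Assign vlist.+1 (Var 0)) (Assign vlist.+1 (Var vlist.+1)) ;;
     Assign vlist (Tl (Var vlist))).

Lemma exec_solve_all (T : eqType) (enc : T -> tree) (ans : T -> Prop) B xs s :
  (forall x, x \in xs -> exists y t,
     [/\ runs p (enc x) y t, y <> Leaf <-> ans x & t <= B]) ->
  s vlist = enc_seq enc xs ->
  exists s' t, [/\ exec solve_all s s' t,
    s' vlist.+1 <> Leaf <-> s vlist.+1 <> Leaf \/ exists2 x, x \in xs & ans x
    & t <= size xs * (B + 2 * vlist + 20) + 2].
Proof.
elim: xs s => [|x xs IH] s hx sE.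
  exists s, 2; split=> //; last by split; [left | case=> // -[]].
  exact: exec_While_false.
have [y [t [[s1 [e1 s1y]] yP tB]]] := hx x (mem_head _ _).
have key : (if y is Leaf then s vlist.+1 else y) <> Leaf <->
    s vlist.+1 <> Leaf \/ ans x.
  by case: y yP {s1y} => [|y1 y2] <-; split=> //; [left | case | right].
pose s2 := overwrite vlist s s1.
pose s3 := update s2 vlist.+1 (if y is Leaf then s vlist.+1 else y).
pose s4 := update s3 vlist (enc_seq enc xs).
have [|//|s' [t' [e' s'P t'B]]] := IH s4 _ _.
  by move=> z zxs; apply: hx; rewrite inE zxs orbT.
  by rewrite /s4 updateE eqxx.
have s20 : s2 0 = y by rewrite /s2 /overwrite /= s1y.
have s2Z v : vlist <= v -> s2 v = s v by move=> h;
  rewrite /s2 /overwrite ltnNge h.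
exists s'; eexists; split.
- apply: exec_While_true e'; first by rewrite /= sE.
  apply: exec_Seq (exec_clear _ _) _.
  apply: (@exec_Seq _ _ _ (overwrite vlist s (update (fun=> Leaf) 0 (enc x)))).
    apply: exec_assign erefl => w.
    rewrite /overwrite !updateE /= /overwrite ltnn sE.
    by case: eqP => // ->.
  apply: exec_Seq (exec_frame s e1 (leqnSn _)) _; rewrite -/s2.
  apply: (@exec_Seq _ _ _ s3 _ 4).
    case: y {yP s1y key} s20 @s3 @s4 s'P => [|y1 y2] s20 s3 s4 s'P.
      apply: (@exec_If_false _ _ _ _ _ 2) => //; apply: exec_assign => // w.
      by rewrite /s3 !updateE /= s2Z.
    apply: (@exec_If_true _ _ _ _ _ 2); first by rewrite /= s20.
    by apply: exec_assign => // w; rewrite /s3 !updateE /= s20.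
  apply: exec_assign erefl => w.
  have s3Z : s3 vlist = s vlist by rewrite /s3 updateE ltn_eqF // s2Z.
  by rewrite /s4 !updateE; case: eqP => //= _; rewrite s3Z sE.
- rewrite s'P /s4 updateE gtn_eqF // /s3 updateE eqxx key.
  split=> [[[|xa]|[z zxs za]]|[|[z]]]; first by left.
  + by right; exists x; rewrite ?mem_head.
  + by right; exists z; rewrite // inE zxs orbT.
  + by left; left.
  + by rewrite inE => /predU1P[-> xa|zxs za]; [left; right | right; exists z].
- by move: t'B tB; rewrite /vlist /=; lia.
Qed.

(** The term variable [vIn] is WHILE variable 3. The input also stays in variable 0, as the bottom
    of the stack. *)
Definition reduction : program :=
  Assign 3 (Var 0) ;;
  compile tInstances ;;
  Assign vlist (Hd (Var 0)) ;;
  Assign vlist.+1 Nil ;;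
  solve_all ;;
  Assign 0 (Var vlist.+1).

Lemma runs_reduction L n (phi : cnf n) (ans : nat * seq bitseq -> Prop) B :
  fits L phi ->
  (forall w, w \in guesses n -> exists y t,
     [/\ runs p (enc_instance (instance phi w)) y t,
         y <> Leaf <-> ans (instance phi w) & t <= B]) ->
  exists y t, [/\ runs reduction (enc_cnf phi) y t,
    y <> Leaf <-> exists2 w, w \in guesses n & ans (instance phi w)
    & t <= tbound L tInstances + L * (B + 2 * vlist + 20) + 20].
Proof.
move=> hf hB; set x := enc_cnf phi.
pose s1 := update (update (fun=> Leaf) 0 x) 3 x.
pose r : env := fun v => s1 v.+1.
have [t1 e1 l1] := evals_instances (r := r) hf erefl (s := s1) (frefl _).
set v := enc_seq _ _ in e1; pose s2 := update s1 0 (Node v (s1 0)).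
pose s3 := update (update s2 vlist v) vlist.+1 Leaf.
have [||s4 [t4 [e4 s4P l4]]] := @exec_solve_all _ enc_instance ans B
  [seq instance phi w | w <- guesses n] s3.
- by move=> _ /mapP[w wg ->]; apply: hB.
- by rewrite /s3 updateE ltn_eqF // updateE eqxx.
exists (s4 vlist.+1); eexists; split.
- exists (update s4 0 (s4 vlist.+1)); split=> //.
  apply: (@exec_Seq _ _ _ s1); first by apply: exec_assign (frefl _) erefl.
  apply: exec_Seq e1 _.
  apply: exec_Seq (exec_assign (frefl _) erefl) _.
  apply: exec_Seq (exec_assign (frefl _) erefl) _.
  apply: exec_Seq e4 _.
  by apply: exec_assign (frefl _) erefl.
- rewrite s4P /s3 updateE eqxx; split; first case=> //.
    by case=> _ /mapP[w wg ->]; exists w.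
  by case=> w wg wa; right; exists (instance phi w); rewrite // map_f.
- have gL : size (guesses n) <= L by rewrite size_bits; case: hf => -[].
  have := leq_mul gL (leqnn (B + 2 * vlist + 20)).
  rewrite size_map in l4 => /(leq_trans _) h;
    have {h}l4 := leq_trans l4 (leq_add (h _ (leqnn _)) (leqnn 2)).
  apply: leq_trans (_ : t1 + t4 + 18 <= _); first by rewrite /=; lia.
  by move: (tbound _ _) l1 => T l1; lia.
Qed.

End Loop.

(** * Instances and alternating arrangements of the universe *)

Definition solvable (I : nat * seq bitseq) : Prop :=
  exists2 s : seq nat, perm_eq s (iota 0 I.1) &
  forall X, X \in I.2 ->
    exists2 j, j.+1 < I.1 &
      nth false X (nth 0 s j) && nth false X (nth 0 s j.+1).

Lemma mem_bits n z : (z \in bits n) = (size z == n).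
Proof.
apply/idP/eqP => [/size_mem_bits //|]; elim: n z => [|n IH] [|b z] //= [/IH zn].
apply/flattenP; exists [:: false :: z; true :: z]; first by apply/mapP;
  exists z.
by case: b; rewrite !inE eqxx ?orbT.
Qed.

Definition tuple_of_sets (I : nat * seq bitseq) :
    (size I.2).-tuple {set 'I_I.1} :=
  map_tuple (fun X => [set i : 'I_I.1 | nth false X i]) (in_tuple I.2).

Lemma enc_tuple_of_sets I : all (fun X => size X == I.1) I.2 ->
  enc_CP (tuple_of_sets I) = enc_instance I.
Proof.
case: I => k Xs /= /allP sX; congr Node; rewrite /tuple_of_sets /=.
have E X : X \in Xs -> enc_set [set i : 'I_k | nth false X i] = enc_bits X.
  move=> /sX /eqP Xk; congr enc_seq; apply: (@eq_from_nth _ false).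
    by rewrite size_map size_enum_ord.
  move=> i; rewrite size_map size_enum_ord => ik.
  by rewrite (nth_map (Ordinal ik)) ?size_enum_ord // inE nth_enum_ord.
elim: Xs {sX} E => //= X Xs IH E; rewrite E ?mem_head // IH // => Y YX.
by apply: E; rewrite inE YX orbT.
Qed.

Lemma solvable_tuple I :
  (exists rho : 'S_I.1, CP_solution (tuple_of_sets I) rho) <-> solvable I.
Proof.
case: I => k Xs; rewrite /solvable /=; split.
  case=> rho sol; exists [seq val (rho i) | i <- enum 'I_k].
    apply: uniq_perm; rewrite ?iota_uniq //.
      rewrite map_inj_uniq ?enum_uniq // => i j /val_inj; exact: perm_inj.
    move=> x; rewrite mem_iota /=; apply/mapP/idP => [[i _ ->]|xk];
      first exact: ltn_ord.
    by exists (rho^-1 (Ordinal xk))%g; rewrite ?mem_enum // permKV.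
  move=> X XXs; have iX : index X Xs < size Xs by rewrite index_mem.
  have [j [j' [jj' h1 h2]]] := sol (Ordinal iX).
  exists j; first by rewrite -jj'.
  move: h1 h2; rewrite tnth_map !inE (tnth_nth X) /= nth_index // -jj' => h1 h2.
  by rewrite !(nth_map j) -?enumT ?size_enum_ord // !nth_ord_enum h1.
case=> s sk sol; have ss : size s = k by rewrite (perm_size sk) size_iota.
have us : uniq s by rewrite (perm_uniq sk) iota_uniq.
have ltk (i : 'I_k) : nth 0 s i < k.
  by have := mem_nth 0 (_ : i < size s); rewrite ss (perm_mem sk) mem_iota;
    apply.
have inj : injective (fun i => Ordinal (ltk i)).
  by move=> i j [/eqP]; rewrite nth_uniq ?ss // => /eqP /val_inj.
exists (perm inj) => i; rewrite tnth_map (tnth_nth [::]) /=.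
have [|j jk /andP[h1 h2]] := sol (nth [::] Xs i); first exact: mem_nth.
by exists (Ordinal (ltnW jk)), (Ordinal jk); rewrite !permE !inE.
Qed.

Definition sparse (z : bitseq) : Prop :=
  forall j, nth false z j && nth false z j.+1 = false.

Lemma count_sparse z : sparse z -> count id z <= uphalf (size z).
Proof.
have [m] := ubnP (size z); elim: m z => // m IH [|[] [|[] z]] //=.
- by move=> _ /(_ 0).
- by move=> zm /(fun h j => h j.+2) /IH /= /(_ _); lia.
- by move=> zm /(fun h j => h j.+1) /IH /= /(_ _); lia.
- by move=> zm /(fun h j => h j.+2) /IH /= /(_ _); lia.
Qed.

(* In a path of odd length the even positions form the only independent set of
   more than half of the vertices. *)
Lemma count_sparse_odd z i : sparse z -> odd (size z) -> nth false z i.*2.+1 ->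
  count id z <= (size z)./2.
Proof.
elim: i z => [|i IH] [|a [|b z]] //= sz; rewrite ?nth_nil // negbK => oz zi.
  (* The one at position 1 forces zeros at positions 0 and 2; what follows has even length, so at
     most half of it are ones. *)
  case: b zi sz => // _ sz; case: a sz => sz; first by have := sz 0.
  case: z oz sz => //= -[] z oz sz; first by have := sz 1.
  have /count_sparse : sparse z by move=> j; have := sz j.+3.
  by rewrite /=; lia.
have /IH/(_ oz zi) : sparse z by move=> j; have := sz j.+2.
by case: a b sz => [] [] // /(_ 0) //=; lia.
Qed.

Lemma eq_bits_of_count (s1 s2 : bitseq) : size s1 = size s2 ->
  (forall j, nth false s1 j -> nth false s2 j) -> count id s1 = count id s2 ->
  s1 = s2.
Proof.
move=> sz h12.
have {h12} : all2 implb s1 s2.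
  elim: s1 s2 sz h12 => [|a s1 IH] [|b s2] //= [sz] h.
  by rewrite (IH s2 sz (fun j => h j.+1)) andbT; have := h 0;
    case: a b {h} => [] [] //= ->.
have le t1 t2 : all2 implb t1 t2 -> count id t1 <= count id t2.
  elim: t1 t2 => [|a t1 IH] [|b t2] //= /andP[ab /IH];
    case: a b ab => [] [] //=; lia.
elim: s1 s2 {sz} => [|a s1 IH] [|b s2] //= /andP[ab hs] E.
have := le _ _ hs; case: a b ab E => [] [] //= _ E hle; try lia;
  by rewrite (IH _ hs) //; lia.
Qed.

Fixpoint alternates (b : bool) (z : bitseq) : bool :=
  if z is a :: z' then (a == b) && alternates (~~ b) z' else true.

Lemma nth_alternates b z j : alternates b z -> j < size z ->
  nth false z j = b (+) odd j.
Proof.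
elim: z b j => [|a z IH] b [|j] //= /andP[/eqP ab az] jz;
  first by rewrite addbF.
by rewrite (IH _ _ az) // addNb addbN.
Qed.

Lemma alternates_nth b z :
  (forall j, j < size z -> nth false z j = b (+) odd j) -> alternates b z.
Proof.
elim: z b => [|a z IH] b //= h; have := h 0 isT; rewrite /= addbF => ->.
by rewrite eqxx; apply: IH => j jz; have := h j.+1 jz; rewrite /= addNb addbN.
Qed.

Definition adjacent (V : seq elt) (P : pred elt) : Prop :=
  exists2 j, j.+1 < size V &
    P (nth row_filler V j) && P (nth row_filler V j.+1).

Section Arrangement.
Variables (U : seq elt) (Gs : seq (seq slot)) (h : nat).
Hypothesis size_U : size U = h.*2.+1.
Hypothesis rows_U : count is_row U = h.+1.

(** A big set contains a column, which lies at an odd position. If no two of its elements were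
    consecutive, [count_sparse_odd] would leave it at most h elements, one fewer than there are
    rows. *)
Lemma solvable_of_arrangement V :
  perm_eq V U -> alternates true (map is_row V) ->
  (forall G, G \in Gs -> adjacent V (hits G)) ->
  solvable (size U, cp_sets U Gs).
Proof.
move=> VU altV hV; have sV : size V = size U := perm_size VU.
have /(perm_iotaP row_filler)[s sU VE] := VU.
have ss : size s = size U by rewrite -sV VE size_map.
exists s => // X; rewrite mem_cat => /orP[|/mapP[G GG ->]] /=; last first.
  have [j jV hj] := hV G GG; exists j; first by rewrite -sV.
  have lt i : i < size V -> nth 0 s i < size U.
    by rewrite sV -{1}ss => /(mem_nth 0); rewrite (perm_mem sU) mem_iota.
  rewrite !(nth_map row_filler) ?lt // ?(ltnW jV) //.
  by move: hj; rewrite VE !(nth_map 0) // ss -sV // ltnW.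
rewrite mem_filter mem_bits => /andP[/andP[big /hasP[[u x] uX /= /andP[nu x1]]]
  /eqP sX].
pose z := [seq nth false X i | i <- s].
have cz : count id z = count id X.
  rewrite -[in RHS](mkseq_nth false X) sX /mkseq /z !count_map.
  exact: (seq.permP sU).
case: (boolP [exists j : 'I_(size U), nth false z j && nth false z j.+1]).
  case/existsP => j /andP[z1 z2]; have jU : j.+1 < size U.
    by rewrite ltnNge; apply/negP => le;
      rewrite nth_default // size_map ss in z2.
  by exists j => //; move: z1 z2; rewrite !(nth_map 0) ?ss // => -> ->.
rewrite negb_exists => /forallP sp; exfalso.
have {}sp : sparse z.
  move=> j; have [jU|jU] := ltnP j (size U);
    first exact/negbTE/(sp (Ordinal jU)).
  by rewrite nth_default // size_map ss.
have /(nthP (row_filler, false))[i] := uX.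
rewrite size_zip sX minnn => iU; rewrite nth_zip // => -[uE xE].
have iS : i \in s by rewrite (perm_mem sU) mem_iota.
pose j := index i s; have js : j < size s by rewrite index_mem.
have := nth_alternates altV (j := j); rewrite size_map sV -ss => /(_ js).
rewrite (nth_map row_filler) ?sV -?ss // VE (nth_map 0) // nth_index // uE
  (negbTE nu).
move=> /esym; rewrite -[true]/(~~ false) addNb => /negbFE oj.
have := @count_sparse_odd z j./2 sp;
  rewrite size_map ss size_U /= odd_double /=.
have -> : j./2.*2.+1 = j by rewrite -[RHS]odd_double_half (oj : odd j = true).
rewrite (nth_map 0) // nth_index // xE => /(_ erefl x1).
rewrite cz uphalf_double; move: big; rewrite size_filter rows_U; lia.
Qed.

(** If an even position held a column, the set of all elements at even positions would be big, hence
    a constraint, although even positions are never consecutive. So even positions hold rows, and as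
    many as there are. *)
Lemma arrangement_of_solvable : solvable (size U, cp_sets U Gs) ->
  exists V, [/\ perm_eq V U, alternates true (map is_row V) &
    forall G, G \in Gs -> adjacent V (hits G)].
Proof.
case=> s /= sU sol; have ss : size s = size U by rewrite (perm_size sU)
  size_iota.
pose V := [seq nth row_filler U i | i <- s].
have VU : perm_eq V U by apply/(perm_iotaP row_filler); exists s.
have us : uniq s by rewrite (perm_uniq sU) iota_uniq.
have lt i : i < size U -> nth 0 s i < size U.
  by rewrite -{1}ss => /(mem_nth 0); rewrite (perm_mem sU) mem_iota.
exists V; split=> // [|G GG]; last first.
  have [|j jU] := sol [seq hits G u | u <- U]; first by rewrite mem_cat;
    apply/orP; right; apply/mapP; exists G.
  rewrite !(nth_map row_filler) ?lt // ?(ltnW jU) // => hj; exists j.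
    by rewrite size_map ss.
  by rewrite !(nth_map 0) ?ss // ltnW.
(* [E] lists membership in the order of the universe, as a constraint must; [e] lists it along the
   path. *)
pose E := [seq ~~ odd (index i s) | i <- iota 0 (size U)].
have nE j : j < size U -> nth false E (nth 0 s j) = ~~ odd j.
  by move=> jU; rewrite (nth_map 0) ?size_iota ?lt // nth_iota ?lt //
    index_uniq ?ss.
pose e := [seq ~~ odd j | j <- iota 0 (size U)].
have eE : [seq nth false E i | i <- s] = e.
  apply: (@eq_from_nth _ false); first by rewrite !size_map size_iota.
  move=> j; rewrite size_map ss => jU.
  by rewrite (nth_map 0) ?ss // nE // (nth_map 0) ?size_iota // nth_iota.
have ce : count id e = h.+1.
  rewrite /e size_U count_map -(eq_count (a1 := predC odd)) //.
  have odds m : count odd (iota 0 m) = m./2.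
    elim: m => // m IH; rewrite -addn1 iotaD count_cat IH /= addn0 addn1 /=
      uphalf_half; lia.
  have := count_predC odd (iota 0 h.*2.+1).
  by rewrite odds size_iota /= uphalf_double; lia.
have cE : count id E = h.+1.
  rewrite -ce -eE -[in LHS](mkseq_nth false E) /mkseq !size_map size_iota
    !count_map.
  exact/esym/(seq.permP sU).
have evenrow j : j < size U -> ~~ odd j -> is_row (nth row_filler V j).
  move=> jU oj; apply/negPn/negP => nr.
  have EE : E \in cp_sets U Gs.
    rewrite mem_cat mem_filter mem_bits size_map size_iota eqxx andbT /is_big.
    rewrite size_filter rows_U cE leqnn /=; apply/orP; left.
    apply/(has_nthP (row_filler, false)); exists (nth 0 s j).
      by rewrite size_zip !size_map size_iota minnn lt.
    rewrite nth_zip ?size_map ?size_iota //= nE // oj andbT.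
    by move: nr; rewrite (nth_map 0) ?ss.
  have [i iU] := sol E EE; rewrite !nE // ?(ltnW iU) //=.
  by case: (odd i).
have <- : e = map is_row V.
  apply: eq_bits_of_count.
  - by rewrite !size_map size_iota ss.
  - move=> j; have [jU|jU] := ltnP j (size U).
      rewrite (nth_map 0) ?size_iota // nth_iota // add0n.
      by rewrite (nth_map row_filler) ?size_map ?ss //; apply: evenrow.
    by rewrite nth_default ?size_map ?size_iota.
  - by rewrite ce count_map (seq.permP VU).
apply: alternates_nth => j; rewrite size_map size_iota => jU.
by rewrite (nth_map 0) ?size_iota // nth_iota.
Qed.

End Arrangement.

(** * Soundness *)

Definition is_row_of (c x : nat) (u : elt) : bool :=
  [&& u.1 == c, is_row u & nth false u.2.2 x].

Lemma count_rows_universe ms cs :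
  count is_row (universe ms cs) = (1 + 3 * (size ms + size cs)).+1.
Proof.
have lay c : count is_row (layer ms cs c) = size ms + size cs.
  rewrite /layer count_cat; congr addn; [elim: ms | elim: cs] => //= ? ? ->;
    lia.
rewrite /universe; move: (layer ms cs) lay => lay E.
by rewrite !count_cat !E /=; lia.
Qed.

Lemma rows_class_universe ms cs :
  all (fun u => is_row u ==> (u.1 < 3)) (universe ms cs).
Proof.
have lay c : c < 3 -> all (fun u => is_row u ==> (u.1 < 3)) (layer ms cs c).
  move=> c3; rewrite /layer all_cat.
  by apply/andP; split; [elim: ms | elim: cs] => //= ? ? ->; rewrite ?c3.
by rewrite /universe !all_cat; apply/and5P; split=> //; rewrite -all_cat;
  apply: lay.
Qed.

Lemma count_rows_of_universe ms cs c x : c < 3 ->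
  count (is_row_of c x) (universe ms cs) = count (fun m => nth false m x) ms.
Proof.
have lay d : count (is_row_of c x) (layer ms cs d) =
    (d == c) * count (fun m => nth false m x) ms.
  rewrite /layer count_cat.
  have -> : count (is_row_of c x)
      (flatten [seq [:: col_el d l; row_filler] | l <- cs]) = 0.
    by elim: cs => //= l s ->; rewrite /is_row_of /= nth_nil !andbF.
  rewrite addn0; elim: ms => [|m ms IH] //=; first by rewrite muln0.
  by rewrite IH /is_row_of /= andbF /=; case: eqP; lia.
rewrite /universe; move: (layer ms cs) lay => lay E c3.
rewrite !count_cat !E /= {1 2 3}/is_row_of /= nth_nil !andbF.
by case: c c3 {E} => [|[|[|c]]] //= _; lia.
Qed.

Lemma count1_nth (T : Type) (p : pred T) x0 s : count p s = 1 ->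
  exists2 i, i < size s & forall j, j < size s -> p (nth x0 s j) = (j == i).
Proof.
elim: s => //= y s IH; case py: (p y) => /= E.
  have np : ~~ has p s by rewrite has_count; lia.
  exists 0 => // -[|j] //= js; apply/negbTE; apply: contra np => pj.
  by apply/(has_nthP x0); exists j.
have [i is_ h] := IH E; exists i.+1 => // -[|j] //=; last exact: h.
Qed.

Section Soundness.
Variables (n : nat) (V : seq elt).
Hypothesis altV : alternates true (map is_row V).
Hypothesis classV : all (fun u => is_row u ==> (u.1 < 3)) V.
Hypothesis rowV : forall c x, c < 3 -> x < n -> count (is_row_of c x) V = 1.
Hypothesis varV : forall x G, x < n -> G \in var_clauses x ->
  adjacent V (hits G).

Local Notation nthV := (nth row_filler V).

Definition neighbours (u w : elt) : Prop :=
  exists2 j, j.+1 < size V & (u = nthV j /\ w = nthV j.+1) \/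
                             (w = nthV j /\ u = nthV j.+1).

Lemma adjacent_row G : adjacent V (hits G) ->
  exists u w, [/\ neighbours u w, is_row u, ~~ is_row w, hits G u & hits G w].
Proof.
case=> j jV /andP[h1 h2].
have r i : i < size V -> is_row (nthV i) = ~~ odd i.
  by move=> iV; have := nth_alternates altV; rewrite size_map => /(_ _ iV);
    rewrite (nth_map row_filler).
have := r _ jV; have := r _ (ltnW jV); rewrite /= negbK => r1 r2.
case oj: (odd j) r1 r2 => r1 r2;
  [exists (nthV j.+1), (nthV j) | exists (nthV j), (nthV j.+1)];
  split; rewrite ?r1 ?r2 //; exists j; tauto.
Qed.

Lemma neighbours_class u w : neighbours u w -> is_row u -> u.1 < 3.
Proof.
case=> j jV h; have /allP cV := classV.
have uV : u \in V by case: h => -[]; [move=> -> _ | move=> _ ->];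
  rewrite mem_nth // ltnW.
by have /implyP := cV u uV.
Qed.

Lemma hits_row G u : is_row u -> hits G u ->
  exists x p, nth None G u.1 = Some (x, p) /\ nth false u.2.2 x.
Proof. by rewrite /hits => ru; case: nth => // -[x p]; rewrite ru;
  exists x, p. Qed.

(** Filler neighbours are exempt. The clause [w.1 = c] prevents a row of one copy from meeting a
    constraint with a column of another copy. *)
Definition valued (c x : nat) (v : bool) : Prop := forall u w,
  neighbours u w -> is_row_of c x u -> w.1 <> 3 ->
  w.1 = c /\ nth false w.2.2 x = v.

Lemma adjacent_value G : nth None G 3 = None -> adjacent V (hits G) ->
  exists c x p, [/\ c < 3, nth None G c = Some (x, p) &
    forall v, valued c x v -> if v then p.1 else p.2].
Proof.
move=> G3 /adjacent_row[u [w [nbw ru rw hu hw]]].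
have u3 := neighbours_class nbw ru.
have [x [p [gE ux]]] := hits_row ru hu.
exists u.1, x, p; split=> // v vv.
have w3 : w.1 <> 3 by move=> w3; move: hw; rewrite /hits w3 G3.
have [|wu wx] := vv u w nbw _ w3; first by rewrite /is_row_of eqxx ru.
by move: hw; rewrite /hits (negbTE rw) wu gE /= wx.
Qed.

(* A row has a filler on one side, hence at most one column of its class. *)
Lemma row_value c x : c < 3 -> x < n -> exists v, valued c x v.
Proof.
move=> c3 xn; have [i iV hi] := count1_nth row_filler (rowV c3 xn).
have nb u w : neighbours u w -> is_row_of c x u ->
    w = nthV i.+1 /\ i.+1 < size V \/ exists2 i', i = i'.+1 & w = nthV i'.
  move=> [j jV [[-> ->]|[-> ->]]].
    by rewrite hi ?(ltnW jV) // => /eqP ji; left; rewrite -ji.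
  by rewrite hi // => /eqP ji; right; exists j.
(* [G1] yields a filler [w1] beside the row, [G2] a column [w2] of class [c]. *)
pose G1 := nth [::] (var_clauses x) c;
  pose G2 := nth [::] (var_clauses x) (3 + c).
have G1V : G1 \in var_clauses x by rewrite mem_nth //=; lia.
have G2V : G2 \in var_clauses x by rewrite mem_nth //=; lia.
have [u1 [w1 [nb1 ru1 rw1 hu1 hw1]]] := adjacent_row (varV xn G1V).
have [u2 [w2 [nb2 ru2 rw2 hu2 hw2]]] := adjacent_row (varV xn G2V).
have u13 := neighbours_class nb1 ru1; have u23 := neighbours_class nb2 ru2.
have u1c : is_row_of c x u1.
  have [y [p [gE uy]]] := hits_row ru1 hu1.
  move: gE uy; rewrite /is_row_of ru1 /G1.
  by move: (u1.1) u13 => d;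
    case: c c3 {G1 G2 G1V G2V hu1 hu2 hw1 hw2 hi nb iV} => [|[|[|c]]] // _;
    case: d => [|[|[|d]]] //= _ [<- _] ->.
have u2c : is_row_of c x u2.
  have [y [p [gE uy]]] := hits_row ru2 hu2.
  move: gE uy; rewrite /is_row_of ru2 /G2.
  by move: (u2.1) u23 => d;
    case: c c3 {G1 G2 G1V G2V hu1 hu2 hw1 hw2 hi nb iV u1c} => [|[|[|c]]] // _;
    case: d => [|[|[|d]]] //= _ [<- _] ->.
have w13 : w1.1 = 3.
  move: hw1; rewrite /hits (negbTE rw1) /G1.
  by move: (w1.1) => d; case: c c3 {G1 G2 G1V G2V hu1 hu2 hw2 hi nb iV u1c u2c}
    => [|[|[|c]]] // _;
    case: d => [|[|[|[|d]]]] //=; rewrite ?nth_nil //; case: ifP.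
have w2c : w2.1 = c.
  move: hw2; rewrite /hits (negbTE rw2) /G2.
  by move: (w2.1) => d; case: c c3 {G1 G2 G1V G2V hu1 hu2 hw1 hi nb iV u1c u2c}
    => [|[|[|c]]] // _;
    case: d => [|[|[|[|d]]]] //=; rewrite ?nth_nil.
exists (nth false w2.2.2 x) => u w nbw uc w3.
suff -> : w = w2 by [].
have w23 : w2.1 <> 3 by rewrite w2c => E; rewrite E in c3.
(* The row has two sides. Since [w1] and [w2] differ in class they occupy both, and [w], not being a
   filler, is on the side of [w2]. *)
case: (nb _ _ nb1 u1c) => [[E1 _]|[i1 ii1 E1]];
case: (nb _ _ nb2 u2c) => [[E2 _]|[i2 ii2 E2]];
case: (nb _ _ nbw uc) => [[E _]|[i3 ii3 E]]; try congruence.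
Qed.

Lemma variable_value x : x < n -> exists v, forall c, c < 3 -> valued c x v.
Proof.
move=> xn.
have [v0 h0] := @row_value 0 x isT xn.
have [v1 h1] := @row_value 1 x isT xn.
have [v2 h2] := @row_value 2 x isT xn.
pose G i := nth [::] (var_clauses x) (6 + i).
have GV i : i < 3 -> adjacent V (hits (G i)).
  by move=> i3; apply: varV xn _; rewrite mem_nth.
have v01 : v0 -> v1.
  have [] := adjacent_value _ (GV 0 isT) => // c [y [p [c3 + hv]]].
  by case: c c3 hv => [|[|[|c]]] //= _ hv [yE pE]; move: hv;
    rewrite -yE -pE => hv;
    [have := hv _ h0 | have := hv _ h1]; case: v0 h0; case: v1 h1.
have v12 : v1 -> v2.
  have [] := adjacent_value _ (GV 1 isT) => // c [y [p [c3 + hv]]].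
  by case: c c3 hv => [|[|[|c]]] //= _ hv [yE pE]; move: hv;
    rewrite -yE -pE => hv;
    [have := hv _ h1 | have := hv _ h2]; case: v1 h1 {v01}; case: v2 h2.
have v20 : v2 -> v0.
  have [] := adjacent_value _ (GV 2 isT) => // c [y [p [c3 + hv]]].
  by case: c c3 hv => [|[|[|c]]] //= _ hv [yE pE]; move: hv;
    rewrite -yE -pE => hv;
    [have := hv _ h0 | have := hv _ h2]; case: v0 h0 {v01}; case: v2 h2 {v12}.
exists v0; case=> [|[|[|c]]] // _.
  by have -> : v0 = v1 by apply/idP/idP; auto.
by have -> : v0 = v2 by apply/idP/idP; auto.
Qed.

Lemma satisfiable_of_arrangement (phi : cnf n) :
  all (fun C => size C <= 3) phi ->
  (forall G, G \in phi_clauses phi -> adjacent V (hits G)) -> satisfiable phi.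
Proof.
move=> /allP phi3 hphi.
have /fin_all_exists[a ha] : forall i : 'I_n, exists v, forall c, c < 3 ->
  valued c i v.
  by move=> i; apply: variable_value.
exists a; apply/allP => C Cphi; have C3 := phi3 C Cphi.
pose G := [seq slot_lit (val l.1) l.2 | l <- C].
have G3 : nth None G 3 = None by rewrite nth_default // size_map.
have [|c [x [p [c3 gE hv]]]] := adjacent_value G3 (hphi G _);
  first exact: map_f.
have cC : c < size C.
  by rewrite ltnNge; apply/negP => le; rewrite nth_default // size_map in gE.
have [l0 _] : exists l0, l0 \in C by case: (C) cC => // l0 s; exists l0;
  rewrite mem_head.
move: gE; rewrite (nth_map l0) //; set l := nth l0 _ _ => -[xE pE].
apply/hasP; exists l; first exact: mem_nth.
have := hv (a l.1); rewrite -xE -pE /= => /(_ (ha _ _ c3)).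
by case: (a l.1) (l.2) => [] [].
Qed.

End Soundness.

(** * Completeness *)

Section Completeness.
Variables (n : nat) (ms : seq bitseq).
Variables (label : bitseq -> bitseq) (a : nat -> bool).
Hypothesis ms_cover : forall x, x < n -> has (fun m => nth false m x) ms.
Hypothesis label_val : forall (m : bitseq) (x : nat),
  m \in ms -> x < n -> nth false m x ->
  nth false (label m) x = a x.

(** The row has its filler on the left and its column on the right. The block ends with a row, so
    blocks can be chained after any prefix that ends with a row. *)
Definition block (c : nat) (m : bitseq) : seq elt :=
  [:: col_filler; row_el c m; col_el c (label m); row_filler].
Definition blocks (c : nat) : seq elt := flatten [seq block c m | m <- ms].
Definition arrangement : seq elt :=
  [:: row_filler; col_filler; row_filler] ++
  (blocks 0 ++ (blocks 1 ++ (blocks 2 ++ [::]))).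

Lemma perm_arrangement cs : perm_eq cs (map label ms) ->
  perm_eq arrangement (universe ms cs).
Proof.
move=> csP; have bl c : perm_eq (blocks c) (layer ms cs c).
  have /perm_flatten E := perm_map (fun l => [:: col_el c l; row_filler]) csP.
  apply/seq.permP => p; rewrite count_cat (seq.permP E) /blocks.
  by elim: ms => //= m s ->; lia.
rewrite /arrangement /universe perm_cat2l.
by do 3 (apply: perm_cat; first exact: bl).
Qed.

Lemma alternates_arrangement : alternates true (map is_row arrangement).
Proof.
have bl c s : alternates false (map is_row s) ->
    alternates false (map is_row (blocks c ++ s)).
  by move=> hs; rewrite /blocks; elim: ms => //= m ms' ->.
by rewrite /arrangement; do 3 apply: (bl).
Qed.

Lemma adjacent_infix P s1 s s2 : adjacent s P -> adjacent (s1 ++ s ++ s2) P.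
Proof.
case=> j js hj; exists (size s1 + j); first by rewrite !size_cat; lia.
have E i : i < size s ->
    nth row_filler (s1 ++ s ++ s2) (size s1 + i) = nth row_filler s i.
  by move=> si; rewrite !nth_cat ltnNge leq_addr /= addKn si.
by rewrite -addnS !E ?(ltnW js).
Qed.

Lemma adjacent_block P c m : c < 3 -> m \in ms -> adjacent (block c m) P ->
  adjacent arrangement P.
Proof.
move=> c3 mms h.
have [s1 [s2 bE]] : exists s1 s2, blocks c = s1 ++ block c m ++ s2.
  rewrite /blocks; case/path.splitPr: mms => ms1 ms2.
  by rewrite map_cat flatten_cat /=; do 2 eexists; rewrite [LHS]/=.
have {s1 s2 bE}h : adjacent (blocks c) P by rewrite bE; apply: adjacent_infix.
have cat3 s1 s2 s3 : s1 ++ (s2 ++ s3) = s1 ++ s2 ++ s3 by [].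
rewrite /arrangement; case: c c3 h => [|[|[|c]]] // _ h.
- exact: adjacent_infix.
- by rewrite (catA _ (blocks 0)); apply: adjacent_infix.
- by rewrite (catA (blocks 0)) (catA _ (blocks 0 ++ _)); apply: adjacent_infix.
Qed.

Lemma adjacent_arrangement (G : seq slot) c x p : c < 3 -> x < n ->
  nth None G c = Some (x, p) -> (if a x then p.1 else p.2) ->
  adjacent arrangement (hits G).
Proof.
move=> c3 xn gE px; have /hasP[m mms mx] := ms_cover xn.
(* Positions 1 and 2 of the block: the row and its own column. *)
apply: (adjacent_block c3 mms); exists 1 => //=.
by rewrite /hits /= gE /= mx (label_val mms xn mx) px.
Qed.

Lemma adjacent_var_clauses x G : x < n -> G \in var_clauses x ->
  adjacent arrangement (hits G).
Proof.
move=> xn; have /hasP[m mms mx] := ms_cover xn.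
have fil c : c < 3 ->
    nth None G c = slot_none x -> nth None G 3 = slot_full 0 ->
    adjacent arrangement (hits G).
  move=> c3 gc g3; apply: (adjacent_block c3 mms); exists 0 => //=.
  by rewrite /hits /= gc g3 /= mx.
have lit c p : c < 3 -> nth None G c = Some (x, p) ->
    (if a x then p.1 else p.2) -> adjacent arrangement (hits G).
  by move=> c3 gc; apply: adjacent_arrangement gc.
rewrite !inE => /or4P[/eqP GE|/eqP GE|/eqP GE|
  /or4P[/eqP GE|/eqP GE|/eqP GE|/or3P[]/eqP GE]].
- by apply: (fil 0); rewrite ?GE.
- by apply: (fil 1); rewrite ?GE.
- by apply: (fil 2); rewrite ?GE.
- by apply: (lit 0 (true, true)); rewrite ?GE //; case: (a x).
- by apply: (lit 1 (true, true)); rewrite ?GE //; case: (a x).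
- by apply: (lit 2 (true, true)); rewrite ?GE //; case: (a x).
- case ax: (a x); [apply: (lit 1 (true, false)) | apply: (lit 0 (false, true))];
    by rewrite ?GE ?ax.
- case ax: (a x); [apply: (lit 2 (true, false)) | apply: (lit 1 (false, true))];
    by rewrite ?GE ?ax.
- case ax: (a x); [apply: (lit 0 (true, false)) | apply: (lit 2 (false, true))];
    by rewrite ?GE ?ax.
Qed.

Lemma adjacent_phi_clauses (phi : cnf n) G : all (fun C => size C <= 3) phi ->
  all (has (fun l : literal n => a (val l.1) == l.2)) phi ->
  G \in phi_clauses phi -> adjacent arrangement (hits G).
Proof.
move=> /allP phi3 /allP sat /mapP[C Cphi ->].
have /hasP[l lC al] := sat C Cphi.
have iC : index l C < size C by rewrite index_mem.
apply: (@adjacent_arrangement _ (index l C) (val l.1) (l.2, ~~ l.2)).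
- exact: leq_trans iC (phi3 C Cphi).
- exact: ltn_ord.
- by rewrite (nth_map l) // nth_index.
- by rewrite (eqP al); case: l.2.
Qed.

End Completeness.

(** * Groups, labels and correctness of the reduction *)

Lemma iota_rcons k : iota 0 k.+1 = rcons (iota 0 k) k.
Proof. by rewrite -addn1 iotaD cats1. Qed.

Lemma masksP n b : 0 < b -> exists g,
  [/\ masks n b = rev [seq group_mask b (b * t) | t <- iota 0 g], n <= b * g
    & b * g < n + b].
Proof.
move=> b0; rewrite /masks.
(* Each step adds a group until [n] is covered; groups are nonempty, so [n] steps suffice. *)
have inv j : exists g, [/\ iter j (mask_step n b) (0, [::]) =
    (b * g, rev [seq group_mask b (b * t) | t <- iota 0 g]), b * g < n + b
    & j <= g \/ n <= b * g].
  elim: j => [|j [g [E lt le]]].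
    by exists 0; rewrite muln0 /=; split=> //; [lia | left].
  rewrite iterS E /mask_step /=; case: ltnP => h.
    exists g.+1; rewrite mulnS iota_rcons map_rcons rev_rcons.
    by split=> //; [lia | left; case: le; lia].
  by exists g; split=> //; right.
have [g [-> lt le]] := inv n; exists g; split=> //.
case: le => // /leq_trans; apply; exact: leq_pmull.
Qed.

Lemma nth_group_mask b p x : nth false (group_mask b p) x = (p <= x < p + b).
Proof.
rewrite nth_cat size_nseq !nth_nseq; case: ltnP => // px; rewrite ?if_same //.
by rewrite ltn_subLR //; case: ltnP.
Qed.

Lemma count_masks n b x : 0 < b -> x < n ->
  count (fun m => nth false m x) (masks n b) = 1.
Proof.
move=> b0 xn; have [g [-> le _]] := masksP n b0; rewrite count_rev count_map.
rewrite (eq_count (a2 := pred1 (x %/ b))) => [|t]; last first.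
  have -> : pred1 (x %/ b) t = (t <= x %/ b) && (x %/ b < t.+1).
    by rewrite ltnS -eqn_leq.
  by rewrite /= nth_group_mask leq_divRL // ltn_divLR // mulSn addnC mulnC.
rewrite count_uniq_mem ?iota_uniq // mem_iota /= add0n ltn_divLR //.
by rewrite mulnC (leq_trans xn le).
Qed.

Lemma nth_iter_cat (T : Type) (x0 : T) y n x : x < n * size y ->
  nth x0 (iter n (cat y) [::]) x = nth x0 y (x %% size y).
Proof.
elim: n x => // n IH x xn; rewrite iterS nth_cat.
case: ltnP => h; first by rewrite modn_small.
rewrite IH; last by move: xn; rewrite mulSn; lia.
by rewrite -[in RHS](subnK h) modnDr.
Qed.

(** Induction on [ls]: write one [true] for every occurrence of the first label in [cs], then
    [false], and continue with the other elements of [cs]. *)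
Lemma decodeP (ls cs : seq bitseq) : {subset cs <= ls} ->
  exists2 w, size w = size cs + size ls & perm_eq (decode ls w) cs.
Proof.
rewrite /decode; set acc := [::] => sub.
suff [w sw [cs' E cs'P]] : exists2 w, size w = size cs + size ls &
    exists2 cs', (foldl dec_step (ls, acc) w).2 = cs' ++ acc & perm_eq cs' cs.
  by exists w; rewrite // E cats0.
elim: ls cs acc sub => [|l ls IH] cs acc sub.
  by case: cs sub => [|c cs] sub; [exists [::]; rewrite //;
    exists [::] | have := sub c (mem_head _ _)].
pose c := count_mem l cs; pose cs1 := seq.filter (predC1 l) cs.
have [|w sw [cs' E cs'P]] := IH cs1 (nseq c l ++ acc).
  move=> y; rewrite mem_filter /= => /andP[yl /sub].
  by rewrite inE (negbTE yl).
exists (nseq c true ++ false :: w).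
  have := count_predC (pred1 l) cs; rewrite -/c.
  rewrite -[count (predC _) cs]/(count (predC1 l) cs) -[count _ cs]size_filter
    -/cs1.
  by rewrite size_cat size_nseq /= sw; lia.
have ones k acc' :
    foldl dec_step (l :: ls, acc') (nseq k true) = (l :: ls, nseq k l ++ acc').
  by elim: k acc' => //= k IHk acc'; rewrite IHk; congr pair;
    elim: k {IHk} => //= k ->.
exists (cs' ++ nseq c l).
  by rewrite foldl_cat ones /= E catA.
rewrite perm_catC (permPl (perm_cat (perm_refl _) cs'P)).
have -> : nseq c l = seq.filter (pred1 l) cs.
  by rewrite /c -size_filter; apply/esym/all_pred1P/filter_all.
exact/permPl/(perm_filterC (pred1 l) cs).
Qed.

Lemma blkP n : [/\ 0 < blk n, n <= 4 ^ blk n & blk n = 1 \/ 4 ^ (blk n).-1 < n].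
Proof.
rewrite /blk /blk_iter.
have inv j : exists b, [/\ iter j (blk_step n) (4, 1) = (4 ^ b, b), 0 < b,
    b = 1 \/ 4 ^ b.-1 < n & j < b \/ n <= 4 ^ b].
  elim: j => [|j [b [E b0 h1 h2]]]; first by exists 1; split=> //; left.
  rewrite iterS E /blk_step /=; case: ltnP => h.
    exists b.+1; rewrite expnS; split=> //; [by right | left; case: h2; lia].
  by exists b; split=> //; right.
have [b [-> b0 h1 h2]] := inv n; split=> //=.
by case: h2 => // nb; rewrite (leq_trans (ltnW nb)) // ltnW // ltn_expl.
Qed.

(** A satisfying assignment dictates the guess. Conversely every guess is safe: whatever columns it
    provides, a solution reads a satisfying assignment off them. *)
Lemma reduction_correct n (phi : cnf n) : is_3cnf phi ->
  satisfiable phi <-> exists2 w, w \in guesses n & solvable (instance phi w).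
Proof.
case/andP=> _ phi3; have [b0 _ _] := blkP n.
split=> [[a0 sat]|[w _]].
  (* The last group may extend past the [n] variables, so the assignment is made total. *)
  pose a x := if insub x is Some i then a0 i else false.
  have aE (i : 'I_n) : a i = a0 i by rewrite /a valK.
  have [g [mE _ _]] := masksP n b0.
  set b := blk n in b0 mE *; set ms := masks n b.
  pose label m : bitseq :=
    (* [index true m] is the first variable of the group with mask [m]. *)
    iter n (cat (mkseq (fun q => a (index true m + q)) b)) [::].
  have label_in : {subset map label ms <= labels n b}.
    move=> _ /mapP[m _ ->]; apply: map_f; rewrite mem_bits size_mkseq //.
  have [w sw wP] := decodeP label_in.
  exists w; first by rewrite /guesses mem_bits sw size_map size_cat.
  have cover x : x < n -> has (fun m => nth false m x) ms.
    by move=> xn; rewrite has_count count_masks.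
  have val m x : m \in ms -> x < n -> nth false m x ->
      nth false (label m) x = a x.
    rewrite /ms mE mem_rev => /mapP[t _ ->] xn;
      rewrite nth_group_mask => /andP[tx xt].
    rewrite /label; set y := mkseq _ _.
    have sy : size y = b by rewrite size_mkseq.
    rewrite nth_iter_cat sy; last by rewrite (leq_trans xn) // leq_pmulr.
    have iE : index true (group_mask b (b * t)) = b * t.
      rewrite index_cat mem_nseq andbF size_nseq -(prednK b0) /=; lia.
    have xE : x %% b = x - b * t.
      by rewrite -(subnKC tx) mulnC modnMDl modn_small ?addKn //; lia.
    by rewrite xE nth_mkseq ?iE; [congr a; lia | lia].
  apply: (@solvable_of_arrangement _ _ (1 + 3 * (size ms + size (decode (labels
    n b) w)))
    _ _ (arrangement ms label)).
  - by rewrite size_universe -/b -/ms; lia.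
  - exact: count_rows_universe.
  - exact: perm_arrangement.
  - exact: alternates_arrangement.
  - move=> G; rewrite mem_cat => /orP[/flattenP[Gs /mapP[x]]|].
      rewrite mem_rev mem_iota => /= xn -> GG.
      exact: adjacent_var_clauses cover val _ _ xn GG.
    apply: adjacent_phi_clauses cover val _ _ phi3 _.
    by apply: sub_all sat => C; apply: sub_has => l; rewrite aE.
move=> /(@arrangement_of_solvable _ _ (1 + 3 * (size (masks n (blk n)) +
  size (decode (labels n (blk n)) w)))).
case=> [||V [VU altV hV]].
- by rewrite size_universe; lia.
- exact: count_rows_universe.
apply: (@satisfiable_of_arrangement n V) => //.
- by rewrite (perm_all _ VU) rows_class_universe.
- by move=> c x c3 xn; rewrite (seq.permP VU) count_rows_of_universe //
  count_masks.
- move=> x G xn GG; apply: hV; rewrite mem_cat; apply/orP; left.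
  apply/flattenP; exists (var_clauses x) => //.
  by apply: map_f; rewrite mem_rev mem_iota.
- by move=> G GG; apply: hV; rewrite mem_cat GG orbT.
Qed.

(** * Size of the instances *)

Definition guess_size (n : nat) : nat :=
  size (masks n (blk n) ++ labels n (blk n)).

Lemma size_labels n b : size (labels n b) = 2 ^ b.
Proof. by rewrite size_map size_bits. Qed.

Lemma guess_size_ge2 n : 2 ^ blk n <= guess_size n /\ 2 <= guess_size n.
Proof.
have [b0 _ _] := blkP n; rewrite /guess_size size_cat size_labels.
have : 2 ^ 1 <= 2 ^ blk n by rewrite leq_pexp2l.
by rewrite expn1; lia.
Qed.

(** With g groups and b = [blk n]: g * b < n + b, and b <= 2^b * b <= 4^b <= 4 * n by the minimality
    of b. The total is n + 4n + 4n. *)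
Lemma guess_size_blk n : 0 < n -> guess_size n * blk n <= 9 * n.
Proof.
move=> n0; have [b0 _ h] := blkP n; have [g [mE _ lt]] := masksP n b0.
rewrite /guess_size size_cat size_labels mE size_rev size_map size_iota.
set b := blk n in b0 h lt *.
have bB : 2 ^ b * b <= 4 * n.
  apply: (@leq_trans (4 ^ b)).
    rewrite -[4]/(2 * 2) expnMn leq_mul2l; apply/orP; right.
    by rewrite ltnW // ltn_expl.
  case: h => [->|lt4]; first by rewrite expn1; lia.
  by rewrite -(prednK b0) expnS leq_mul2l ltnW.
have : b <= 2 ^ b * b by rewrite leq_pmull // expn_gt0.
by rewrite mulnDl [g * b]mulnC; lia.
Qed.

(** By n <= 4^b = (2^b)^2. Thus a polynomial in n is 2^O(Q), where Q is [guess_size n]. *)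
Lemma leq_guess_size n : n <= guess_size n ^ 2.
Proof.
have [_ h _] := blkP n; have [h2 _] := guess_size_ge2 n.
by rewrite (leq_trans h) // -[4]/(2 ^ 2) -expnM mulnC expnM leq_exp2r.
Qed.

Lemma size_decode ls w : size (decode ls w) <= size w.
Proof.
suff E st : size (foldl dec_step st w).2 <= size st.2 + size w.
  exact: E (ls, [::]).
elim: w st => [|b w IH] st /=; first by rewrite addn0.
by rewrite (leq_trans (IH _)) //; case: b => /=; lia.
Qed.

Lemma size_universe_of n w : w \in guesses n ->
  size (universe_of n w) <= 12 * guess_size n + 3.
Proof.
rewrite /guesses mem_bits => /eqP sw; rewrite size_universe.
have := size_decode (labels n (blk n)) w; rewrite sw -/(guess_size n).
have : size (masks n (blk n)) <= guess_size n by rewrite /guess_size size_cat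
  leq_addr.
lia.
Qed.

(** A list of length at most 3 is determined by its three entries of type [option T]. *)
Lemma size_clauses_leq3 (T : finType) (s : seq (seq T)) :
  uniq s -> all (fun C => size C <= 3) s -> size s <= #|T|.+1 ^ 3.
Proof.
move=> us /allP s3.
pose f (C : seq T) := (onth C 0, onth C 1, onth C 2).
have inj : {in s &, injective f}.
  move=> C D /s3 + /s3; rewrite /f.
  by case: C D => [|? [|? [|? [|? ?]]]] [|? [|? [|? [|? ?]]]] //= _ _ [] *;
    subst.
have : #|[seq f C | C <- s]| <= #|{: option T * option T * option T}| by apply:
  max_card.
rewrite (card_uniqP _) ?map_inj_in_uniq // size_map !card_prod card_option.
by rewrite !expnS expn0 muln1 mulnA.
Qed.

Lemma size_3cnf n (phi : cnf n) : is_3cnf phi -> size phi <= (2 * n).+1 ^ 3.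
Proof.
case/andP=> up p3; have := size_clauses_leq3 up p3.
by rewrite card_prod card_ord card_bool mulnC.
Qed.

Lemma size_clauses n (phi : cnf n) : size (clauses phi) = 9 * n + size phi.
Proof.
rewrite size_cat size_map; congr addn.
have E s : size (flatten [seq var_clauses x | x <- s]) = 9 * size s.
  by elim: s => //= x s ->; lia.
by rewrite E size_rev size_iota.
Qed.

Lemma size_clauses_3cnf n (phi : cnf n) : is_3cnf phi ->
  size (clauses phi) <= 2 ^ (20 * guess_size n).
Proof.
move=> /size_3cnf p3; have nQ := leq_guess_size n;
  have [_ Q2] := guess_size_ge2 n.
rewrite size_clauses; set Q := guess_size n in nQ Q2 *.
have QL : Q ^ 2 <= 2 ^ (2 * Q) by rewrite mulnC expnM leq_exp2r // ltnW //
  ltn_expl.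
set E := 2 ^ (2 * Q) in QL.
have E16 : 16 <= E by rewrite -[16]/(2 ^ 4) leq_pexp2l //; lia.
have -> : 20 * Q = 2 * Q * 10 by lia.
rewrite expnM -/E; have p : (2 * n).+1 ^ 3 <= (3 * E) ^ 3 by rewrite leq_exp2r
  //; lia.
have : 9 * n + size phi <= 9 * E + 27 * E ^ 3.
  by rewrite leq_add ?leq_mul2l ?(leq_trans nQ QL) // (leq_trans p3) //
    (leq_trans p) // expnMn.
(* The factor E^7 absorbs the coefficient 36 = 9 + 27 of E^3. *)
move=> /leq_trans; apply; rewrite -[10]/(3 + 7) expnD.
have : 16 ^ 7 <= E ^ 7 by rewrite leq_exp2r.
have : 1 <= E ^ 3 by rewrite expn_gt0; lia.
have : E <= E ^ 3 by rewrite -{1}[E]expn1 leq_pexp2l //; lia.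
have : 36 <= 16 ^ 7 by [].
nia.
Qed.

Lemma fits_3cnf n (phi : cnf n) :
  is_3cnf phi -> fits (2 ^ (20 * guess_size n)) phi.
Proof.
move=> phi3; have cL := size_clauses_3cnf phi3; have := cL;
  rewrite size_clauses => sL.
have nQ := leq_guess_size n; have [bQ Q2] := guess_size_ge2 n.
have Qb := ltn_expl (blk n) (ltnSn 1).
have QL : guess_size n ^ 2 <= 2 ^ (2 * guess_size n).
  by rewrite mulnC expnM leq_exp2r // ltnW // ltn_expl.
have big m : m <= 20 * guess_size n -> 2 ^ m <= 2 ^ (20 * guess_size n).
  by move=> h; rewrite leq_pexp2l.
have L16 : 2 ^ (2 * guess_size n) * 16 <= 2 ^ (20 * guess_size n).
  by rewrite -[16]/(2 ^ 4) -expnD big //; lia.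
have E16 : 16 <= 2 ^ (2 * guess_size n) by rewrite -[16]/(2 ^ 4) leq_pexp2l //;
  lia.
split; split=> //.
- lia.
- have : guess_size n <= guess_size n ^ 2 by rewrite -{1}[guess_size n]expn1
  leq_pexp2l //; lia.
  lia.
- have : guess_size n <= guess_size n ^ 2 by rewrite -{1}[guess_size n]expn1
  leq_pexp2l //; lia.
  lia.
- by apply: big; rewrite -/(guess_size n); lia.
- by move=> w /size_universe_of h; apply: big; lia.
- lia.
- have /andP[_] := phi3; apply: sub_all => C; lia.
Qed.

(** The whole universe is a big set, because it contains a filler column. Subsets and clauses number
    at most 2^(20 * Q) each, with Q = [guess_size n]. *)
Lemma size_instance n (phi : cnf n) w : is_3cnf phi -> w \in guesses n ->
  0 < size (instance phi w).2 <= 2 ^ (21 * guess_size n).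
Proof.
move=> phi3 wg; have cL := size_clauses_3cnf phi3.
have [_ [UL _ _ _]] := fits_3cnf phi3; have {}UL := UL w wg.
have [_ Q2] := guess_size_ge2 n.
rewrite /instance /= size_cat size_map; apply/andP; split.
  rewrite addn_gt0; apply/orP; left.
  have : nseq (size (universe_of n w)) true \in
      [seq X <- bits (size (universe_of n w)) | is_big (universe_of n w) X].
    rewrite mem_filter mem_bits size_nseq eqxx andbT /is_big.
    by apply/andP; split; first by rewrite size_filter count_nseq mul1n
      count_size.
  by case: seq.filter.
have : size
    [seq X <- bits (size (universe_of n w)) | is_big (universe_of n w) X]
    <= 2 ^ (20 * guess_size n).
  by rewrite (leq_trans _ UL) // -size_bits size_filter count_size.
have -> : 21 * guess_size n = 20 * guess_size n + guess_size n by lia.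
have : 2 ^ 1 <= 2 ^ guess_size n by rewrite leq_pexp2l //; lia.
by rewrite expnD; nia.
Qed.

Lemma all_size_instance n (phi : cnf n) w :
  all (fun X => size X == (instance phi w).1) (instance phi w).2.
Proof.
rewrite all_cat; apply/andP; split; apply/allP => X.
  by rewrite mem_filter mem_bits => /andP[].
by move=> /mapP[G _ ->]; rewrite size_map.
Qed.

(** * Asymptotics *)

Local Open Scope classical_set_scope.
Local Open Scope ring_scope.

Section Asymptotics.
Variables (R : realType) (f : nat -> R).
Hypothesis f_small : f =o_\oo (fun k : nat => k%:R * ln (k%:R : R)).

Lemma little_oP (u v : nat -> R) : u =o_\oo v <->
  forall e, 0 < e -> exists N, forall n, (N <= n)%N -> `|u n| <= e * `|v n|.
Proof.
split=> [/eqoP h e e0|h].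
  have [N _ hN] := h e e0; by exists N => n nN; apply: hN.
apply/eqoP => e e0; have [N hN] := h e e0.
by exists N => // n; apply: hN.
Qed.

(** [f] need not be monotone or nonnegative, and the size of the universe depends on the guess; this
    bounds [f] on all sizes that can occur. *)
Definition fmax (n : nat) : R :=
  \big[Num.max/0]_(k < (12 * guess_size n + 3).+1) `|f k|.

Lemma fmax_ge0 n : 0 <= fmax n.
Proof. exact: bigmax_ge_id. Qed.

Lemma le_fmax n k : (k <= 12 * guess_size n + 3)%N -> f k <= fmax n.
Proof.
move=> kn; rewrite (le_trans (ler_norm _)) //.
exact: (le_bigmax_cond 0 (fun k : 'I__ => `|f k|) (j := Ordinal (kn : (k <
  _.+1)%N))).
Qed.

(** By [guess_size_blk] it is enough that [blk n] exceeds 9 / e, which holds for n > 4^A. *)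
Lemma guess_size_o e : 0 < e ->
  exists N, forall n, (N <= n)%N -> (guess_size n)%:R <= e * n%:R :> R.
Proof.
move=> e0; pose A := (Num.truncn (9 / e)).+1.
have hA : 9 / e <= A%:R.
  by have /andP[_ /ltW] := truncn_itv (ltW (divr_gt0 (ltr0Sn R 8) e0)).
exists (4 ^ A).+1 => n nA; have n0 : (0 < n)%N by apply: leq_trans nA.
have [_ nb _] := blkP n.
have Ab : (A <= blk n)%N.
  by rewrite -(leq_exp2l (m := 4)) //; lia.
have h := guess_size_blk n0.
have {}h : (guess_size n * A <= 9 * n)%N by apply: leq_trans h;
  rewrite leq_mul2l Ab orbT.
have {}h : (guess_size n)%:R * A%:R <= 9 * n%:R :> R by rewrite -!natrM ler_nat.
have A0 : 0 < A%:R :> R by rewrite ltr0n.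
rewrite -(ler_pM2r A0) (le_trans h) // mulrAC ler_wpM2r // mulrC -ler_pdivrMr
  //.
Qed.

(** With Q = [guess_size n] and b = [blk n]: K <= 15 * Q <= 135 * n <= 4^(b + 4), so ln K <= 4 * (b
    + 4) <= 20 * b, and 15 * 20 * 9 = 2700. *)
Lemma entropy_guess_size : exists2 c : R, 0 < c & forall n, (0 < n)%N ->
  (12 * guess_size n + 3)%:R * ln (12 * guess_size n + 3)%:R <= c * n%:R.
Proof.
exists 2700%:R; first by rewrite ltr0n.
move=> n n0; set K := (12 * guess_size n + 3)%N.
have h := guess_size_blk n0; have [b0 nb _] := blkP n.
have [_ Q2] := guess_size_ge2 n.
have KQ : (K <= 15 * guess_size n)%N by rewrite /K; lia.
have Kb : (K <= 4 ^ (blk n + 4))%N.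
  have : (guess_size n <= guess_size n * blk n)%N by rewrite leq_pmulr.
  by rewrite expnD -[(4 ^ 4)%N]/256%N; lia.
have K0 : 0 < K%:R :> R by rewrite ltr0n /K; lia.
have lnK : ln K%:R <= (20 * blk n)%:R :> R.
  apply: (@le_trans _ _ (ln ((4 ^ (blk n + 4))%:R : R))).
    by rewrite ler_ln ?ler_nat // posrE ltr0n expn_gt0.
  rewrite natrX lnXn ?ltr0n // -[leLHS]mulr_natl.
  have ln4 : ln (4%:R : R) <= 4 by exact/ltW/ln_sublinear.
  apply: (@le_trans _ _ ((blk n + 4)%:R * 4)); first by rewrite ler_wpM2l.
  by rewrite -natrM ler_nat; lia.
have ln0 : 0 <= ln (K%:R : R) by rewrite ln_ge0 // ler1n /K; lia.
apply: (@le_trans _ _ ((15 * guess_size n)%:R * (20 * blk n)%:R)).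
  by rewrite ler_pM ?ler_nat // ltW.
by rewrite -!natrM ler_nat; lia.
Qed.

(** The linear term gets e / 3. In [fmax], indices below the threshold [k0] contribute at most the
    constant [M], and the others are controlled by k * ln k <= K * ln K <= c * n, where K is the
    largest size. *)
Lemma fmax_o (C : nat) :
  (fun n => fmax n + (C * guess_size n)%:R) =o_\oo (fun n : nat => n%:R : R).
Proof.
apply/little_oP => e e0.
have [c c0 ent] := entropy_guess_size.
have e1 : 0 < e / (3 * c) by rewrite divr_gt0 // mulr_gt0.
have e2 : 0 < e / (3 * C.+1%:R) by rewrite divr_gt0 // mulr_gt0.
have [k0 hk] := (little_oP f _).1 f_small _ e1.
have [N1 hN1] := guess_size_o e2.
pose M : R := \big[Num.max/0]_(k < k0) `|f k|.
have M0 : 0 <= M by exact: bigmax_ge_id.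
pose N2 := (Num.truncn (3 * M / e)).+1.
exists (maxn N1 N2) => n; rewrite geq_max => /andP[n1 n2].
have n0 : (0 < n)%N by apply: leq_trans n2.
have Mn : M <= e / 3 * n%:R.
  have /andP[_ /ltW hM] := truncn_itv (divr_ge0 (mulr_ge0 (ler0n R 3) M0) (ltW
    e0)).
  have {}hM : 3 * M / e <= n%:R by rewrite (le_trans hM) // ler_nat.
  by move: hM; rewrite ler_pdivrMr //; lra.
have Q1 : (C * guess_size n)%:R <= e / 3 * n%:R :> R.
  have := hN1 n n1; rewrite natrM => hQ.
  apply: (@le_trans _ _ (C.+1%:R * (e / (3 * C.+1%:R) * n%:R))).
    by rewrite ler_pM // ler_nat.
  rewrite le_eqVlt; apply/orP; left; apply/eqP.
  have := ltr0Sn R C; move: (C.+1%:R : R) => D D0.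
  by field; rewrite gt_eqF.
have {}ent := ent n n0; set K := (12 * guess_size n + 3)%N in ent.
have Q2 : fmax n <= e / 3 * n%:R + e / 3 * n%:R.
  rewrite /fmax; apply: bigmax_le => [|[k kK] _ /=].
    by rewrite addr_ge0 // mulr_ge0 // divr_ge0 // ltW.
  have [kk|kk] := ltnP k k0.
    apply: (@le_trans _ _ M).
      exact: (le_bigmax_cond 0 (fun k : 'I__ => `|f k|) (j := Ordinal kk)).
    by rewrite (le_trans Mn) // lerDl mulr_ge0 // divr_ge0 // ltW.
  apply: (@le_trans _ _ (e / 3 * n%:R));
    last by rewrite lerDl mulr_ge0 // divr_ge0 // ltW.
  apply: le_trans (hk k kk) _.
  have kln : 0 <= k%:R * ln (k%:R : R) <= K%:R * ln (K%:R : R).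
    case: (posnP k) => [->|kp].
      by rewrite mul0r lexx /= mulr_ge0 // ln_ge0 // ler1n /K; lia.
    have lk : 0 <= ln (k%:R : R) by rewrite ln_ge0 // ler1n.
    rewrite mulr_ge0 //= ler_pM ?ler_nat //.
    by rewrite ler_ln ?ler_nat // posrE ltr0n // /K; lia.
  case/andP: kln => k1 k2; rewrite ger0_norm //.
  apply: (@le_trans _ _ (e / (3 * c) * (c * n%:R))).
    by rewrite ler_wpM2l ?(ltW e1) // (le_trans k2).
  by rewrite le_eqVlt; apply/orP; left; apply/eqP; field; rewrite gt_eqF.
rewrite !ger0_norm ?ler0n // ?addr_ge0 ?fmax_ge0 //.
by move: Q1 Q2; lra.
Qed.

End Asymptotics.

(** * Total running time and conclusion *)

Lemma time_exponent (c v : nat) : exists C, forall n,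
  (tbound (2 ^ (20 * guess_size n)) tInstances
     + 2 ^ (20 * guess_size n) * v + 20
     + 2 ^ (20 * guess_size n) * (2 ^ (21 * guess_size n)) ^ c
   <= 2 ^ (C * guess_size n))%N.
Proof.
have [W [D hW]] := tbound_poly tInstances.
(* Each summand is a constant times Y^E with Y = 2^Q; the constants W, v, 20 and 1 add up to W + v +
   21, which is at most Y to that power. *)
pose E := (21 * D + 20 + 21 * c)%N; exists (W + v + 21 + E)%N => n.
have [_ Q2] := guess_size_ge2 n; set Q := guess_size n in Q2 *.
pose Y := (2 ^ Q)%N; have YE a : (2 ^ (a * Q) = Y ^ a)%N by rewrite mulnC expnM.
rewrite !YE -expnM -expnD.
have Y2 : (2 <= Y)%N by rewrite -{1}[2%N]expn1 leq_pexp2l //; lia.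
have mono a b : (a <= b)%N -> (Y ^ a <= Y ^ b)%N by move=> h;
  rewrite leq_pexp2l //; lia.
have t1 : (tbound (Y ^ 20) tInstances <= W * Y ^ E)%N.
  rewrite (leq_trans (hW _)) // leq_mul2l; apply/orP; right.
  apply: (@leq_trans ((Y ^ 21) ^ D)); last by rewrite -expnM mono // /E; lia.
  have : (Y ^ 20 < Y ^ 21)%N by rewrite ltn_exp2l.
  by case: (D) => // d h; rewrite leq_exp2r.
have t2 : (Y ^ 20 * v <= v * Y ^ E)%N by rewrite mulnC leq_mul2l mono ?orbT //
  /E; lia.
have t3 : (Y ^ (20 + 21 * c) <= Y ^ E)%N by rewrite mono // /E; lia.
have t4 : (1 <= Y ^ E)%N by rewrite expn_gt0; lia.
have t5 : (W + v + 21 <= Y ^ (W + v + 21))%N by rewrite ltnW // ltn_expl.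
apply: (@leq_trans ((W + v + 21) * Y ^ E));
  last by rewrite expnD leq_mul2r t5 orbT.
by rewrite !mulnDl; lia.
Qed.

Lemma reduction_time (R : realType) (p : program) (f : nat -> R) (c : nat) :
  (forall (k m : nat) (S : m.-tuple {set 'I_k}), (0 < m)%N ->
     exists (y : tree) (t : nat),
       [/\ runs p (enc_CP S) y t, CP_decides S y
         & t%:R <= 2 `^ f k * m%:R ^+ c]) ->
  exists C : nat, forall (n : nat) (phi : cnf n), is_3cnf phi ->
    exists (y : tree) (t : nat),
      [/\ runs (reduction p) (enc_cnf phi) y t, y <> Leaf <-> satisfiable phi
        & t%:R <= 2 `^ (fmax f n + (C * guess_size n)%:R)].
Proof.
move=> alg; have [C hC] := time_exponent c (2 * vlist p + 20).
exists C => n phi phi3; set Q := guess_size n.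
pose X : R := 2 `^ fmax f n; pose Z := ((2 ^ (21 * Q)) ^ c)%N.
have X1 : 1 <= X by rewrite -(powRr0 2) ler_powR ?fmax_ge0 // ler1n.
have XZ0 : 0 <= X * Z%:R by rewrite mulr_ge0 // (le_trans ler01 X1).
have [w wg|y [t [run yP tL]]] :=
  (* Times are natural numbers, so the real bound on a call to the solver may be truncated. *)
  @runs_reduction p _ n phi solvable (Num.truncn (X * Z%:R)) (fits_3cnf phi3).
  have /andP[m0 mL] := size_instance phi3 wg.
  have [y [t [run yP tB]]] := alg _ _ (tuple_of_sets (instance phi w)) m0.
  exists y, t; split.
  - by rewrite -enc_tuple_of_sets //; apply: all_size_instance.
  - exact: iff_trans yP (solvable_tuple _).
  rewrite -ltnS -(ltr_nat R); have /andP[_] := truncn_itv XZ0.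
  apply: le_lt_trans; apply: le_trans tB _.
  rewrite ler_pM ?powR_ge0 // ?ler_powR ?ler1n //.
    exact/le_fmax/size_universe_of.
  by rewrite /Z natrX lerXn2r ?nnegrE // ler_nat.
exists y, t; split=> //; first exact: iff_trans yP (iff_sym (reduction_correct
  phi3)).
have {}tL : t%:R <= (tbound (2 ^ (20 * Q)) tInstances
    + 2 ^ (20 * Q) * (2 * vlist p + 20) + 20)%:R
    + (2 ^ (20 * Q))%:R * (Num.truncn (X * Z%:R))%:R :> R.
  rewrite -natrM -natrD ler_nat (leq_trans tL) // -/Q.
  set T := tbound _ _; set B := Num.truncn _; set L := (2 ^ (20 * Q))%N.
  by rewrite !mulnDr; lia.
have /andP[BX _] := truncn_itv XZ0.
have {}hC : (tbound (2 ^ (20 * Q)) tInstances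
    + 2 ^ (20 * Q) * (2 * vlist p + 20) + 20)%:R
    + (2 ^ (20 * Q))%:R * Z%:R <= (2 ^ (C * Q))%:R :> R.
  by rewrite -natrM -natrD ler_nat; apply: hC.
rewrite powRD ?implybT; last by rewrite pnatr_eq0 implybT.
rewrite powR_mulrn // -natrX -/X; apply: le_trans tL _.
set T := (_ + 20)%N in hC *.
apply: (@le_trans _ _ (X * (T%:R + (2 ^ (20 * Q))%:R * Z%:R))); last first.
  by rewrite ler_wpM2l // (le_trans ler01 X1).
(* As 1 <= X, the time [T] spent outside the solver can be multiplied by X too. *)
rewrite mulrDr lerD //; first by rewrite ler_peMl.
by rewrite mulrCA ler_wpM2l.
Qed.

Theorem theorem14 (R : realType) (eth : ETH R) :
  ~ CP_algorithm R CP_finds /\ ~ CP_algorithm R CP_decides.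
Proof.
have no_decision : ~ CP_algorithm R CP_decides.
  move=> [p [f [c [fo alg]]]]; apply: eth.
  have [C hC] := reduction_time alg.
  exists (reduction p), (fun n => fmax f n + (C * guess_size n)%:R).
  by split=> //; apply: fmax_o.
(* A program that finds solutions also decides: the output is a [Node] exactly when a solution
   exists. *)
split=> // -[p [f [c [fo alg]]]]; apply: no_decision; exists p, f, c;
  split=> //.
move=> k m S m0; have [y [t [run sol tB]]] := alg k m S m0.
exists y, t; split=> //; rewrite /CP_decides.
case: sol => [[rho sol ->]|[nsol ->]]; split=> //.
by exists rho.
Qed.
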